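(* The set of triples $(R,S,t)$ ($R,S$ finite TRSs, $t$ a term) such that $\mathrm{SN}(\to_{\epsilon,R}/\to_S)$ holds on $t$ is $\Pi^1_1$-complete, and the set of pairs $(R,S)$ such that $\mathrm{SN}(\to_{\epsilon,R}/\to_S)$ holds (on all terms) is $\Pi^1_1$-complete. Moreover, $\Pi^1_1$-hardness holds already when restricted to the case $R=S$ (i.e. for the sets $\{(S,t)\mid \mathrm{SN}(\to_{\epsilon,S}/\to_S)\text{ on }t\}$ and $\{S\mid \mathrm{SN}(\to_{\epsilon,S}/\to_S)\}$).
   Context: All TRSs are finite over a finite signature. $\to_{\epsilon,R}$ denotes a rewrite step with a rule of $R$ applied at the root position (no surrounding context). For relations $\to_1,\to_2$, $\to_1/\to_2$ denotes $\to_2^*\cdot\to_1$. $\mathrm{SN}(\to_{\epsilon,R}/\to_S)$ holds on $t$ if there is no infinite sequence $t=t_0,t_1,t_2,\dots$ with $t_i\to_S^*\cdot\to_{\epsilon,R} t_{i+1}$ for all $i$, equivalently every $(\to_{\epsilon,R}\cup\to_S)$-reduction starting from $t$ contains only finitely many $\to_{\epsilon,R}$-steps; it holds (uniformly) if it holds on every term (this is finiteness of the dependency pair problem $\{R,S\}$). TRSs and terms are encoded as natural numbers by a standard Gödel numbering. $\Pi^1_1$ is the class of sets definable by a formula $\forall\alpha\,\varphi$ with $\alpha$ ranging over functions $\mathbb N\to\mathbb N$ and $\varphi$ arithmetical; $B$ is $\Pi^1_1$-complete if $B\in\Pi^1_1$ and every $\Pi^1_1$ set many-one reduces to $B$ via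 a total computable function. *)

(* Defs.v *)
From Stdlib Require Import Arith List Relations.
Import ListNotations.

(* Terms.  A function symbol is a pair (name, arity), where the arity is
   the length of the argument list; a finite TRS together with a term
   therefore always lives over the finite signature of the symbols
   occurring in it. *)
Inductive term : Type :=
| Var : nat -> term
| Fn  : nat -> list term -> term.

Fixpoint subst (sigma : nat -> term) (t : term) : term :=
  match t with
  | Var x => sigma x
  | Fn f ts => Fn f (map (subst sigma) ts)
  end.

Inductive var_occ (x : nat) : term -> Prop :=
| vo_var : var_occ x (Var x)
| vo_fn : forall f ts u, In u ts -> var_occ x u -> var_occ x (Fn f ts).

Definition rule : Type := (term * term)%type.
Definition trs : Type := list rule.

Definition wf_rule (rl : rule) : Prop :=
  (forall x, fst rl <> Var x) /\ (forall x, var_occ x (snd rl) -> var_occ x (fst rl)).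

Definition wf_trs (R : trs) : Prop := forall rl, In rl R -> wf_rule rl.

Definition root_step (R : trs) (s t : term) : Prop :=
  exists l r sigma, In (l, r) R /\ s = subst sigma l /\ t = subst sigma r.

Inductive rstep (R : trs) : term -> term -> Prop :=
| rs_root : forall s t, root_step R s t -> rstep R s t
| rs_ctx : forall f ls rs s t,
    rstep R s t -> rstep R (Fn f (ls ++ s :: rs)) (Fn f (ls ++ t :: rs)).

Definition rel_step (R S : trs) (s u : term) : Prop :=
  exists v, clos_refl_trans term (rstep S) s v /\ root_step R v u.

Definition SN_rel_on (R S : trs) (t : term) : Prop :=
  ~ exists seq : nat -> term, seq 0 = t /\ forall i, rel_step R S (seq i) (seq (Nat.succ i)).

Definition SN_rel (R S : trs) : Prop := forall t, SN_rel_on R S t.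

Definition cpair (a b : nat) : nat := (a + b) * (a + b + 1) / 2 + b.

Fixpoint enc_term (t : term) : nat :=
  match t with
  | Var x => 2 * x
  | Fn f ts =>
      S (2 * cpair f
        ((fix encl (l : list term) : nat :=
            match l with
            | nil => 0
            | u :: l' => S (cpair (enc_term u) (encl l'))
            end) ts))
  end.

Fixpoint enc_trs (R : trs) : nat :=
  match R with
  | nil => 0
  | (l, r) :: R' => S (cpair (cpair (enc_term l) (enc_term r)) (enc_trs R'))
  end.

Inductive prog : Type :=
| PZero : prog
| PSucc : prog
| PProj : nat -> prog
| PComp : prog -> list prog -> prog
| PRec  : prog -> prog -> prog
| PMu   : prog -> prog.

Inductive eval : prog -> list nat -> nat -> Prop :=
| ev_zero : forall v, eval PZero v 0
| ev_succ : forall x v, eval PSucc (x :: v) (S x)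
| ev_proj : forall i v, i < length v -> eval (PProj i) v (nth i v 0)
| ev_comp : forall f gs v ws y, evals gs v ws -> eval f ws y -> eval (PComp f gs) v y
| ev_rec0 : forall f g v y, eval f v y -> eval (PRec f g) (0 :: v) y
| ev_recS : forall f g n v y z,
    eval (PRec f g) (n :: v) y -> eval g (n :: y :: v) z -> eval (PRec f g) (S n :: v) z
| ev_mu : forall f v n,
    eval f (n :: v) 0 -> (forall m, m < n -> exists k, eval f (m :: v) (S k)) ->
    eval (PMu f) v n
with evals : list prog -> list nat -> list nat -> Prop :=
| evs_nil : forall v, evals nil v nil
| evs_cons : forall g gs v y ys, eval g v y -> evals gs v ys -> evals (g :: gs) v (y :: ys).

Definition computable (f : nat -> nat) : Prop :=
  exists p, forall n, eval p [n] (f n).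

(* Arithmetical formulas with one function parameter alpha (de Bruijn). *)
Inductive aterm : Type :=
| tvar : nat -> aterm
| tzero : aterm
| tsucc : aterm -> aterm
| tplus : aterm -> aterm -> aterm
| tmult : aterm -> aterm -> aterm
| tapp : aterm -> aterm.

Inductive aform : Type :=
| feq : aterm -> aterm -> aform
| flt : aterm -> aterm -> aform
| fnot : aform -> aform
| fand : aform -> aform -> aform
| for_ : aform -> aform -> aform
| fimp : aform -> aform -> aform
| fall : aform -> aform
| fex : aform -> aform.

Definition scons (x : nat) (e : nat -> nat) : nat -> nat :=
  fun i => match i with 0 => x | S j => e j end.

Fixpoint teval (alpha : nat -> nat) (e : nat -> nat) (t : aterm) : nat :=
  match t with
  | tvar i => e i
  | tzero => 0
  | tsucc u => S (teval alpha e u)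
  | tplus u w => teval alpha e u + teval alpha e w
  | tmult u w => teval alpha e u * teval alpha e w
  | tapp u => alpha (teval alpha e u)
  end.

Fixpoint sat (alpha : nat -> nat) (e : nat -> nat) (phi : aform) : Prop :=
  match phi with
  | feq u w => teval alpha e u = teval alpha e w
  | flt u w => teval alpha e u < teval alpha e w
  | fnot p => ~ sat alpha e p
  | fand p q => sat alpha e p /\ sat alpha e q
  | for_ p q => sat alpha e p \/ sat alpha e q
  | fimp p q => sat alpha e p -> sat alpha e q
  | fall p => forall x, sat alpha (scons x e) p
  | fex p => exists x, sat alpha (scons x e) p
  end.

Definition Pi11 (B : nat -> Prop) : Prop :=
  exists phi, forall n, B n <-> (forall alpha, sat alpha (scons n (fun _ => 0)) phi).

Definition many_one_reduces (A B : nat -> Prop) : Prop :=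
  exists f, computable f /\ forall n, A n <-> B (f n).

Definition Pi11_hard (B : nat -> Prop) : Prop :=
  forall A, Pi11 A -> many_one_reduces A B.

Definition Pi11_complete (B : nat -> Prop) : Prop := Pi11 B /\ Pi11_hard B.

Definition SNrel_triples (n : nat) : Prop :=
  exists R S t, wf_trs R /\ wf_trs S /\
    n = cpair (enc_trs R) (cpair (enc_trs S) (enc_term t)) /\ SN_rel_on R S t.

Definition SNrel_pairs (n : nat) : Prop :=
  exists R S, wf_trs R /\ wf_trs S /\
    n = cpair (enc_trs R) (enc_trs S) /\ SN_rel R S.

Definition SNrel_diag_pairs (n : nat) : Prop :=
  exists S t, wf_trs S /\ n = cpair (enc_trs S) (enc_term t) /\ SN_rel_on S S t.

Definition SNrel_diag (n : nat) : Prop :=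
  exists S, wf_trs S /\ n = enc_trs S /\ SN_rel S S.

(* Main.v *)
(* Membership: terms and TRSs are coded bijectively by natural numbers, so an infinite
   relative reduction, together with all auxiliary data (substitutions, contexts,
   intermediate rewrite sequences), can be stored in one function alpha on which only
   arithmetical local conditions are imposed; this avoids any coding of finite sequences.

   Hardness: Skolemization brings the complement of a Pi11 set into the form
   "exists ga, forall x, p = q" for two terms p, q over 0, S, +, * and ga.  A TRS guesses
   longer and longer finite initial segments of ga; a root step leading to stage x + 1 is
   possible only after the equation has been verified for all y <= x with the
   current segment.  All other root steps decrease the root symbol, and
   all guessed data are copied by functions that only return constructor terms, so that
   an infinite reduction from an arbitrary, possibly junk, term still yields ga. *)

From Stdlib Require Import Arith List Relations Lia Classical ClassicalEpsilon FunctionalExtensionality.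
Require Import Defs.
Import ListNotations.

(** * Coding of terms and rewrite systems *)

(** With [R = S] every root step counts, and the initial term is arbitrary; both facts shape the
    system. A collapsing rule such as [Add(0, x) -> x] could release any root symbol hidden in [x],
    so results are passed through [sCopy], which produces only constructors at the root; this makes
    a rank on root symbols possible. The guessed segments may stay bounded along an infinite
    reduction: reading past the end of a list is stuck, so a check that reaches zero has used known
    values only and is valid for every function extending the segment. One system serves all four
    sets: [A n] gives termination on all terms, and termination on the single term [start] gives
    [A n]. *)

Lemma double_cpair a b : 2 * cpair a b = (a + b) * (a + b + 1) + 2 * b.
Proof.
  unfold cpair.
  assert (H : Nat.even ((a + b) * (a + b + 1)) = true).
  { generalize (a + b). intro m. rewrite Nat.even_mul, Nat.even_add. now destruct (Nat.even m). }
  apply Nat.even_spec in H. destruct H as [k Hk]. rewrite Hk.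
  rewrite (Nat.mul_comm 2 k), Nat.div_mul by lia. lia.
Qed.

(** The language of arithmetic has no division. Doubling turns the graph of [cpair] into a
    polynomial equation, which formulas and [bterm] can express. *)
Lemma eq_cpair_iff w a b : w = cpair a b <-> 2 * w = (a + b) * (a + b + 1) + 2 * b.
Proof. rewrite <- double_cpair. lia. Qed.

Lemma cpair_inj a b a' b' : cpair a b = cpair a' b' -> a = a' /\ b = b'.
Proof.
  intro H. pose proof (double_cpair a b) as H1. pose proof (double_cpair a' b') as H2.
  rewrite H in H1. rewrite H1 in H2.
  assert (a + b = a' + b') by nia. nia.
Qed.

Lemma cpair_surj w : exists a b, w = cpair a b.
Proof.
  induction w as [|w (a & b & IH)]; [now exists 0, 0|].
  apply eq_cpair_iff in IH. destruct a as [|a].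
  - exists (S b), 0. apply eq_cpair_iff. lia.
  - exists a, (S b). apply eq_cpair_iff. lia.
Qed.

Lemma le_cpair_l a b : a <= cpair a b.
Proof. pose proof (double_cpair a b). nia. Qed.

Lemma le_cpair_r a b : b <= cpair a b.
Proof. pose proof (double_cpair a b). nia. Qed.

(** Names the anonymous inner fixpoint of [enc_term], so that [enc_Fn] holds by conversion. *)
Fixpoint enc_list (l : list term) : nat :=
  match l with
  | nil => 0
  | u :: l' => S (cpair (enc_term u) (enc_list l'))
  end.

Lemma enc_Fn f ts : enc_term (Fn f ts) = S (2 * cpair f (enc_list ts)).
Proof. reflexivity. Qed.

Lemma term_list_ind (P : term -> Prop) (Q : list term -> Prop) :
  (forall x, P (Var x)) -> (forall f ts, Q ts -> P (Fn f ts)) ->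
  Q nil -> (forall u l, P u -> Q l -> Q (u :: l)) ->
  (forall t, P t) /\ (forall l, Q l).
Proof.
  intros Hv Hf Hn Hc.
  assert (HP : forall t, P t).
  { fix IH 1. intros [x|f ts]; [apply Hv|]. apply Hf.
    induction ts as [|u l IHl]; [apply Hn|apply Hc; [apply IH|apply IHl]]. }
  split; [exact HP|]. induction l; auto.
Qed.

Lemma enc_term_list_inj :
  (forall t u, enc_term t = enc_term u -> t = u) /\
  (forall l k, enc_list l = enc_list k -> l = k).
Proof.
  apply term_list_ind.
  - intros x [y|g us]; [|rewrite enc_Fn]; cbn [enc_term]; intro H; [f_equal|]; lia.
  - intros f ts IH [y|g us]; rewrite !enc_Fn; cbn [enc_term]; intro H; [lia|].
    assert (H' : cpair f (enc_list ts) = cpair g (enc_list us)) by lia.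
    apply cpair_inj in H'. destruct H' as [-> H']. f_equal. now apply IH.
  - intros [|v k]; simpl; [reflexivity|lia].
  - intros u l IHu IHl [|v k]; simpl; [lia|]. intro H. injection H as H.
    apply cpair_inj in H. destruct H. f_equal; auto.
Qed.

(** Since every number codes a term and also a list, number quantifiers in the formulas range over
    exactly the coded objects. *)
Lemma enc_term_list_surj n : (exists t, n = enc_term t) /\ (exists l, n = enc_list l).
Proof.
  induction n as [n IH] using lt_wf_ind. split.
  - destruct (Nat.Even_or_Odd n) as [[k ->]|[k Hk]].
    + now exists (Var k).
    + destruct (cpair_surj k) as (f & m & Hm). pose proof (le_cpair_r f m).
      destruct (proj2 (IH m ltac:(lia))) as [ts ->].
      exists (Fn f ts). rewrite enc_Fn. lia.
  - destruct n as [|n]; [now exists nil|].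
    destruct (cpair_surj n) as (a & b & ->).
    pose proof (le_cpair_l a b). pose proof (le_cpair_r a b).
    destruct (proj1 (IH a ltac:(lia))) as [u ->].
    destruct (proj2 (IH b ltac:(lia))) as [l ->].
    now exists (u :: l).
Qed.

Lemma enc_term_inj t u : enc_term t = enc_term u -> t = u.
Proof. apply enc_term_list_inj. Qed.

Lemma enc_list_inj l k : enc_list l = enc_list k -> l = k.
Proof. apply enc_term_list_inj. Qed.

Lemma enc_term_surj n : exists t, n = enc_term t.
Proof. apply enc_term_list_surj. Qed.

Lemma enc_list_surj n : exists l, n = enc_list l.
Proof. apply enc_term_list_surj. Qed.

Definition enc_rule (rl : rule) : nat := cpair (enc_term (fst rl)) (enc_term (snd rl)).

Lemma enc_rule_inj r r' : enc_rule r = enc_rule r' -> r = r'.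
Proof.
  destruct r, r'. unfold enc_rule. simpl. intro H. apply cpair_inj in H.
  destruct H. f_equal; now apply enc_term_inj.
Qed.

Lemma enc_trs_cons rl R : enc_trs (rl :: R) = S (cpair (enc_rule rl) (enc_trs R)).
Proof. now destruct rl. Qed.

Lemma enc_trs_inj R R' : enc_trs R = enc_trs R' -> R = R'.
Proof.
  revert R'. induction R as [|rl R IH]; intros [|rl' R']; rewrite ?enc_trs_cons; simpl;
    try lia; [reflexivity|].
  intro H. injection H as H. apply cpair_inj in H. destruct H.
  f_equal; [now apply enc_rule_inj|now apply IH].
Qed.

Lemma enc_trs_surj n : exists R, n = enc_trs R.
Proof.
  induction n as [[|n] IH] using lt_wf_ind; [now exists nil|].
  destruct (cpair_surj n) as (a & b & ->).
  destruct (cpair_surj a) as (l & r & ->).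
  pose proof (le_cpair_r (cpair l r) b).
  destruct (IH b ltac:(lia)) as [R ->].
  destruct (enc_term_surj l) as [tl ->], (enc_term_surj r) as [tr ->].
  now exists ((tl, tr) :: R).
Qed.

(** Unlike [cpair] this is a polynomial, so it can be written as a term below a function symbol. It
    is injective because [b] is the excess over the largest square. *)
Definition qpair (a b : nat) : nat := (a + b) * (a + b) + b.

Lemma qpair_inj a b a' b' : qpair a b = qpair a' b' -> a = a' /\ b = b'.
Proof. unfold qpair. intro H. assert (a + b = a' + b') by nia. nia. Qed.

(** Serves to lay out several functions in disjoint regions of one; outside the graph the values are
    arbitrary. *)
Lemma graph_function {X} (G : nat -> X -> Prop) (d : X) :
  (forall m v v', G m v -> G m v' -> v = v') ->
  exists f, forall m v, G m v -> f m = v.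
Proof.
  intro HG.
  exists (fun m => epsilon (inhabits d) (G m)). intros m v Hv.
  apply (HG m); [|exact Hv]. apply epsilon_spec. now exists v.
Qed.

(** * Membership *)

Definition def_term (f : (nat -> nat) -> (nat -> nat) -> nat) : Prop :=
  exists t, forall al e, teval al e t = f al e.

Definition definable (P : (nat -> nat) -> (nat -> nat) -> Prop) : Prop :=
  exists phi, forall al e, sat al e phi <-> P al e.

Lemma def_term_var i : def_term (fun _ e => e i).
Proof. now exists (tvar i). Qed.

Lemma def_term_const n : def_term (fun _ _ => n).
Proof.
  induction n as [|n [t IH]]; [now exists tzero|].
  exists (tsucc t). intros. simpl. now rewrite IH.
Qed.

Lemma def_term_S f : def_term f -> def_term (fun al e => S (f al e)).
Proof. intros [t H]. exists (tsucc t). intros. simpl. now rewrite H. Qed.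

Lemma def_term_add f g : def_term f -> def_term g -> def_term (fun al e => f al e + g al e).
Proof. intros [t H] [u K]. exists (tplus t u). intros. simpl. now rewrite H, K. Qed.

Lemma def_term_mul f g : def_term f -> def_term g -> def_term (fun al e => f al e * g al e).
Proof. intros [t H] [u K]. exists (tmult t u). intros. simpl. now rewrite H, K. Qed.

Lemma def_term_app f : def_term f -> def_term (fun al e => al (f al e)).
Proof. intros [t H]. exists (tapp t). intros. simpl. now rewrite H. Qed.

Lemma definable_eq f g : def_term f -> def_term g -> definable (fun al e => f al e = g al e).
Proof. intros [t H] [u K]. exists (feq t u). intros. simpl. now rewrite H, K. Qed.

Lemma definable_lt f g : def_term f -> def_term g -> definable (fun al e => f al e < g al e).
Proof. intros [t H] [u K]. exists (flt t u). intros. simpl. now rewrite H, K. Qed.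

Lemma definable_not P : definable P -> definable (fun al e => ~ P al e).
Proof. intros [p H]. exists (fnot p). intros. simpl. now rewrite H. Qed.

Lemma definable_and P Q : definable P -> definable Q -> definable (fun al e => P al e /\ Q al e).
Proof. intros [p H] [q K]. exists (fand p q). intros. simpl. now rewrite H, K. Qed.

Lemma definable_or P Q : definable P -> definable Q -> definable (fun al e => P al e \/ Q al e).
Proof. intros [p H] [q K]. exists (for_ p q). intros. simpl. now rewrite H, K. Qed.

Lemma definable_imp P Q : definable P -> definable Q -> definable (fun al e => P al e -> Q al e).
Proof. intros [p H] [q K]. exists (fimp p q). intros. simpl. now rewrite H, K. Qed.

Lemma definable_iff P Q : definable P -> definable Q -> definable (fun al e => P al e <-> Q al e).
Proof. intros. apply definable_and; now apply definable_imp. Qed.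

Lemma definable_forall (P : nat -> (nat -> nat) -> (nat -> nat) -> Prop) :
  definable (fun al e => P (e 0) al (fun i => e (S i))) ->
  definable (fun al e => forall x, P x al e).
Proof.
  intros [p H]. exists (fall p). intros al e. simpl.
  split; intros K x; specialize (K x); now apply (H al (scons x e)).
Qed.

Lemma definable_exists (P : nat -> (nat -> nat) -> (nat -> nat) -> Prop) :
  definable (fun al e => P (e 0) al (fun i => e (S i))) ->
  definable (fun al e => exists x, P x al e).
Proof.
  intros [p H]. exists (fex p). intros al e. simpl.
  split; intros [x K]; exists x; now apply (H al (scons x e)).
Qed.

Lemma definable_cpair w a b :
  def_term w -> def_term a -> def_term b ->
  definable (fun al e => w al e = cpair (a al e) (b al e)).
Proof.
  intros Hw Ha Hb.
  destruct (definable_eq (fun al e => 2 * w al e)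
    (fun al e => (a al e + b al e) * (a al e + b al e + 1) + 2 * b al e)) as [p Hp].
  - repeat (apply def_term_mul || apply def_term_add || apply def_term_const || assumption).
  - repeat (apply def_term_mul || apply def_term_add || apply def_term_const || assumption).
  - exists p. intros. now rewrite Hp, eq_cpair_iff.
Qed.

Ltac solve_def_term :=
  repeat first
    [ apply def_term_var | apply def_term_const | apply def_term_add | apply def_term_mul
    | apply def_term_S | apply def_term_app ].

Ltac solve_definable :=
  cbv beta;
  lazymatch goal with
  | |- definable (fun al e => forall x : nat, _) => apply definable_forall; solve_definable
  | |- definable (fun al e => exists x : nat, _) => apply definable_exists; solve_definable
  | |- definable (fun al e => _ /\ _) => apply definable_and; solve_definable
  | |- definable (fun al e => _ \/ _) => apply definable_or; solve_definable
  | |- definable (fun al e => _ <-> _) => apply definable_iff; solve_definable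
  | |- definable (fun al e => ~ _) => apply definable_not; solve_definable
  | |- definable (fun al e => _ -> _) => apply definable_imp; solve_definable
  | |- definable (fun al e => _ = cpair _ _) => apply definable_cpair; solve_def_term
  | |- definable (fun al e => _ = _) => apply definable_eq; solve_def_term
  | |- definable (fun al e => _ < _) => apply definable_lt; solve_def_term
  end.

Lemma choice_fun {X Y} (P : X -> Y -> Prop) :
  (forall x, exists y, P x y) -> exists f, forall x, P x (f x).
Proof.
  intro H. exists (fun x => proj1_sig (constructive_indefinite_description _ (H x))).
  intro x. apply proj2_sig.
Qed.

(* Tables 0, 1 hold variable occurrence in terms and in lists, table 2 membership
   of a rule in a TRS, tables 3, 4 the substitution number p applied to terms and
   to lists, tables 5, 6 one-step rewriting of terms and of lists, tables 7, 8 the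
   finite rewrite sequences between consecutive root steps and their lengths.
   Predicates are represented by vanishing. *)
Definition occ_table (F : nat -> nat -> nat -> nat) : Prop :=
  (forall x y, F 0 x (2 * y) = 0 <-> x = y) /\
  (forall x f l w, w = cpair f l -> (F 0 x (S (2 * w)) = 0 <-> F 1 x l = 0)) /\
  (forall x, ~ F 1 x 0 = 0) /\
  (forall x u l w, w = cpair u l -> (F 1 x (S w) = 0 <-> F 0 x u = 0 \/ F 1 x l = 0)).

Definition in_table (F : nat -> nat -> nat -> nat) : Prop :=
  (forall a, ~ F 2 a 0 = 0) /\
  (forall a b r w, w = cpair b r -> (F 2 a (S w) = 0 <-> a = b \/ F 2 a r = 0)).

Definition wf_code (F : nat -> nat -> nat -> nat) (r : nat) : Prop :=
  forall a l rr, a = cpair l rr -> F 2 a r = 0 ->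
    (exists k, l = S (2 * k)) /\ forall x, F 0 x rr = 0 -> F 0 x l = 0.

(** The entries at even codes, the variables, are left free: whatever they are, they decode to a
    substitution, and the clauses propagate it to all terms. *)
Definition sub_table (F : nat -> nat -> nat -> nat) : Prop :=
  (forall p f l w w', w = cpair f l -> w' = cpair f (F 4 p l) ->
     F 3 p (S (2 * w)) = S (2 * w')) /\
  (forall p, F 4 p 0 = 0) /\
  (forall p u l w w', w = cpair u l -> w' = cpair (F 3 p u) (F 4 p l) ->
     F 4 p (S w) = S w').

Definition root_code (F : nat -> nat -> nat -> nat) (r s t : nat) : Prop :=
  exists p a l rr, a = cpair l rr /\ F 2 a r = 0 /\ F 3 p l = s /\ F 3 p rr = t.

(** Steps occur only in an asserted reduction, hence implications: each claimed step is justified by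
    a root step or by a claimed step on smaller codes. Occurrence and membership are equivalences
    because [wf_code] must be right for every admissible [al]. *)
Definition step_table (F : nat -> nat -> nat -> nat) (r : nat) : Prop :=
  (forall s t, F 5 s t = 0 -> root_code F r s t \/
     exists f l l' w w', w = cpair f l /\ w' = cpair f l' /\
       s = S (2 * w) /\ t = S (2 * w') /\ F 6 l l' = 0) /\
  (forall l l', F 6 l l' = 0 ->
     (exists u u' k w w', w = cpair u k /\ w' = cpair u' k /\
        l = S w /\ l' = S w' /\ F 5 u u' = 0) \/
     (exists u k k' w w', w = cpair u k /\ w' = cpair u k' /\
        l = S w /\ l' = S w' /\ F 6 k k' = 0)).

Definition red_table (F : nat -> nat -> nat -> nat) (r : nat) : Prop :=
  forall i, (forall j, j < F 8 i 0 -> F 5 (F 7 i j) (F 7 i (S j)) = 0) /\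
    root_code F r (F 7 i (F 8 i 0)) (F 7 (S i) 0).

Lemma var_occ_Fn x f ts : var_occ x (Fn f ts) <-> Exists (var_occ x) ts.
Proof.
  rewrite Exists_exists. split.
  - intro H. inversion H. eauto.
  - intros (u & H & H'). econstructor; eauto.
Qed.

Lemma occ_table_spec F x : occ_table F ->
  (forall t, F 0 x (enc_term t) = 0 <-> var_occ x t) /\
  (forall l, F 1 x (enc_list l) = 0 <-> Exists (var_occ x) l).
Proof.
  intros (H1 & H2 & H3 & H4). apply term_list_ind.
  - intro y. cbn [enc_term]. rewrite H1. split; [intros ->; constructor|now inversion 1].
  - intros f ts IH. rewrite enc_Fn, (H2 _ _ _ _ eq_refl), IH. now rewrite var_occ_Fn.
  - simpl. rewrite Exists_nil. specialize (H3 x). tauto.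
  - intros u l IHu IHl. simpl. rewrite (H4 _ _ _ _ eq_refl), IHu, IHl. now rewrite Exists_cons.
Qed.

Lemma in_table_spec F rl R : in_table F ->
  F 2 (enc_rule rl) (enc_trs R) = 0 <-> In rl R.
Proof.
  intros [H1 H2]. induction R as [|r R IH].
  - simpl. specialize (H1 (enc_rule rl)). tauto.
  - rewrite enc_trs_cons, (H2 _ _ _ _ eq_refl), IH. simpl.
    split; intros [H|H]; auto; left; [symmetry; now apply enc_rule_inj|now subst].
Qed.

Lemma wf_code_spec F R : occ_table F -> in_table F ->
  wf_code F (enc_trs R) <-> wf_trs R.
Proof.
  intros HO HI. split.
  - intros H [l r] Hin. rewrite <- (in_table_spec F _ _ HI) in Hin.
    destruct (H _ _ _ eq_refl Hin) as [[k Hk] Hv]. split; simpl.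
    + intros x ->. cbn [fst enc_term] in Hk. lia.
    + intros x. rewrite <- !(proj1 (occ_table_spec F x HO)). apply Hv.
  - intros H a l rr -> Hin.
    destruct (enc_term_surj l) as [tl ->], (enc_term_surj rr) as [tr ->].
    change (F 2 (enc_rule (tl, tr)) (enc_trs R) = 0) in Hin.
    rewrite (in_table_spec F _ _ HI) in Hin.
    destruct (H _ Hin) as [Hl Hv]. simpl in *. split.
    + destruct tl as [x|f ts]; [now destruct (Hl x)|].
      rewrite enc_Fn. now eexists.
    + intros x. rewrite !(proj1 (occ_table_spec F x HO)). apply Hv.
Qed.

Lemma sub_table_spec F p sg : sub_table F ->
  (forall x, F 3 p (2 * x) = enc_term (sg x)) ->
  (forall t, F 3 p (enc_term t) = enc_term (subst sg t)) /\
  (forall l, F 4 p (enc_list l) = enc_list (map (subst sg) l)).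
Proof.
  intros (H1 & H2 & H3) Hv. apply term_list_ind.
  - intro x. apply Hv.
  - intros f ts IH. cbn [subst]. rewrite !enc_Fn.
    apply (H1 p _ _ _ _ eq_refl). now rewrite IH.
  - apply H2.
  - intros u l IHu IHl. simpl. apply (H3 p _ _ _ _ eq_refl). now rewrite IHu, IHl.
Qed.

Lemma root_code_sound F R s t : in_table F -> sub_table F ->
  root_code F (enc_trs R) (enc_term s) (enc_term t) -> root_step R s t.
Proof.
  intros HI HS (p & a & l & r & -> & Hin & Hl & Hr).
  destruct (enc_term_surj l) as [tl ->], (enc_term_surj r) as [tr ->].
  change (F 2 (enc_rule (tl, tr)) (enc_trs R) = 0) in Hin.
  rewrite (in_table_spec F _ _ HI) in Hin.
  destruct (choice_fun (fun x u => F 3 p (2 * x) = enc_term u)) as [sg Hsg].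
  { intro x. apply enc_term_surj. }
  destruct (sub_table_spec F p sg HS Hsg) as [E _].
  exists tl, tr, sg. rewrite E in Hl, Hr.
  split; [exact Hin|]. split; symmetry; now apply enc_term_inj.
Qed.

Lemma step_table_sound F R : in_table F -> sub_table F -> step_table F (enc_trs R) ->
  (forall s t, F 5 (enc_term s) (enc_term t) = 0 -> rstep R s t) /\
  (forall l l', F 6 (enc_list l) (enc_list l') = 0 ->
     exists ls u u' rs, l = ls ++ u :: rs /\ l' = ls ++ u' :: rs /\ rstep R u u').
Proof.
  intros HI HS [H5 H6]. apply term_list_ind.
  - intros x t H. apply H5 in H. destruct H as [H|(f & l & l' & w & w' & _ & _ & H & _)].
    + apply rs_root. eapply root_code_sound; eauto.
    + cbn [enc_term] in H. lia.
  - intros f ts IH t H. apply H5 in H.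
    destruct H as [H|(g & l & l' & w & w' & -> & -> & Hs & Ht & H)].
    + apply rs_root. eapply root_code_sound; eauto.
    + destruct (enc_list_surj l) as [us ->], (enc_list_surj l') as [us' ->].
      rewrite <- enc_Fn in Hs, Ht. apply enc_term_inj in Hs, Ht.
      injection Hs as -> ->. subst t.
      destruct (IH _ H) as (ls & u & u' & rs & -> & -> & Hu). now apply rs_ctx.
  - intros l' H. apply H6 in H.
    destruct H as [(u & u' & k & w & w' & _ & _ & H & _)|(u & k & k' & w & w' & _ & _ & H & _)];
      discriminate.
  - intros v l IHv IHl l' H. apply H6 in H. simpl in H.
    destruct H as [(u & u' & k & w & w' & -> & -> & E & E' & H)|(u & k & k' & w & w' & -> & -> & E & E' & H)];
      injection E as E; apply cpair_inj in E; destruct E as [<- <-].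
    + destruct (enc_term_surj u') as [tu ->].
      change (enc_list l' = enc_list (tu :: l)) in E'. apply enc_list_inj in E'. subst l'.
      exists [], v, tu, l. auto.
    + destruct (enc_list_surj k') as [lk ->].
      change (enc_list l' = enc_list (v :: lk)) in E'. apply enc_list_inj in E'. subst l'.
      destruct (IHl _ H) as (ls & u & u' & rs & -> & -> & Hu).
      exists (v :: ls), u, u', rs. auto.
Qed.

Lemma red_table_sound F R S' : in_table F -> sub_table F ->
  step_table F (enc_trs S') -> red_table F (enc_trs R) ->
  exists seq, F 7 0 0 = enc_term (seq 0) /\ forall i, rel_step R S' (seq i) (seq (S i)).
Proof.
  intros HI HS HT HR.
  destruct (choice_fun (fun p u => F 7 (fst p) (snd p) = enc_term u)) as [path Hp].
  { intro p. apply enc_term_surj. }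
  exists (fun i => path (i, 0)). split; [apply (Hp (0, 0))|].
  intro i. destruct (HR i) as [Hs Hr].
  exists (path (i, F 8 i 0)). split.
  - revert Hs. generalize (F 8 i 0). intros n Hs. induction n as [|n IH]; [apply rt_refl|].
    eapply rt_trans; [apply IH; auto|]. apply rt_step.
    apply (step_table_sound F S' HI HS HT).
    rewrite <- (Hp (i, n)), <- (Hp (i, S n)). apply Hs. simpl. lia.
  - apply (root_code_sound F); auto.
    rewrite <- (Hp (i, F 8 i 0)), <- (Hp (S i, 0)). exact Hr.
Qed.

Lemma rel_steps_paths R S' seq : (forall i, rel_step R S' (seq i) (seq (S i))) ->
  exists (path : nat -> nat -> term) (len : nat -> nat), (forall i, path i 0 = seq i) /\
    (forall i j, j < len i -> rstep S' (path i j) (path i (S j))) /\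
    (forall i, root_step R (path i (len i)) (path (S i) 0)).
Proof.
  intro H.
  assert (Hp : forall i, exists pl : (nat -> term) * nat, fst pl 0 = seq i /\
    (forall j, j < snd pl -> rstep S' (fst pl j) (fst pl (S j))) /\
    root_step R (fst pl (snd pl)) (seq (S i))).
  { intro i. destruct (H i) as (v & Hv & Hr).
    apply clos_rt_rt1n in Hv. revert Hr. generalize (seq (S i)). intros z Hz.
    induction Hv as [x|x y v Hxy _ IH].
    - exists (fun _ => x, 0). simpl. repeat split; auto. lia.
    - destruct (IH Hz) as ([f n] & H0 & Hs & He). simpl in *.
      exists (fun j => match j with 0 => x | S j => f j end, S n). simpl.
      repeat split; auto. intros [|j] Hj; [now subst|]. apply Hs. lia. }
  apply choice_fun in Hp. destruct Hp as [pl Hpl].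
  exists (fun i => fst (pl i)), (fun i => snd (pl i)).
  repeat split; intro i; try apply Hpl. rewrite (proj1 (Hpl (S i))). apply Hpl.
Qed.

(** The tables index substitutions by numbers although there are uncountably many of them; one per
    root step, indexed by the codes of the system and of both terms, is enough. *)
Lemma enumerate_substs : exists sg : nat -> nat -> term,
  forall R s t, root_step R s t ->
    exists p l r, In (l, r) R /\ s = subst (sg p) l /\ t = subst (sg p) r.
Proof.
  destruct (choice_fun (fun p (sg : nat -> term) =>
    forall R s t, p = cpair (enc_trs R) (cpair (enc_term s) (enc_term t)) ->
    root_step R s t -> exists l r, In (l, r) R /\ s = subst sg l /\ t = subst sg r))
    as [sg Hsg].
  - intro p. destruct (classic (exists R s t,
      p = cpair (enc_trs R) (cpair (enc_term s) (enc_term t)) /\ root_step R s t))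
      as [(R & s & t & -> & l & r & sg & H)|H].
    + exists sg. intros R' s' t' E _.
      apply cpair_inj in E. destruct E as [E1 E2]. apply cpair_inj in E2. destruct E2 as [E2 E3].
      apply enc_trs_inj in E1. apply enc_term_inj in E2, E3. subst. eauto.
    + exists Var. intros R s t E Hr. destruct H. eauto.
  - exists sg. intros R s t H.
    exists (cpair (enc_trs R) (cpair (enc_term s) (enc_term t))). now apply (Hsg _ R).
Qed.

Definition tab (al : nat -> nat) (i x y : nat) : nat := al (qpair i (qpair x y)).

Lemma tab_surj F : exists al, tab al = F.
Proof.
  destruct (graph_function (fun m v => exists i x y, m = qpair i (qpair x y) /\ v = F i x y) 0)
    as [al H].
  - intros m v v' (i & x & y & -> & ->) (i' & x' & y' & E & ->).
    apply qpair_inj in E. destruct E as [-> E]. apply qpair_inj in E. now destruct E as [-> ->].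
  - exists al. do 3 (apply functional_extensionality; intro). apply H. now repeat eexists.
Qed.

(** The tables are filled with the truth about decoded objects. The system of the root steps stays
    open, because it may differ from [S']. *)
Lemma tables_exist S' (path : nat -> nat -> term) (len : nat -> nat) :
  exists al, let F := tab al in
    occ_table F /\ in_table F /\ sub_table F /\ step_table F (enc_trs S') /\
    (forall i j, F 7 i j = enc_term (path i j)) /\ (forall i, F 8 i 0 = len i) /\
    (forall R s t, root_step R s t -> root_code F (enc_trs R) (enc_term s) (enc_term t)) /\
    (forall s t, rstep S' s t -> F 5 (enc_term s) (enc_term t) = 0).
Proof.
  pose (chi := fun P : Prop => if excluded_middle_informative P then 0 else 1).
  assert (Hchi : forall P, chi P = 0 <-> P).
  { intro P. unfold chi. destruct excluded_middle_informative; split; intros; try easy. }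
  destruct (choice_fun _ enc_term_surj) as [dec Hdec].
  destruct (choice_fun _ enc_list_surj) as [decl Hdecl].
  assert (Edec : forall t, dec (enc_term t) = t) by (intro; symmetry; apply enc_term_inj, Hdec).
  assert (Edecl : forall l, decl (enc_list l) = l) by (intro; symmetry; apply enc_list_inj, Hdecl).
  assert (Edec_var : forall x, dec (2 * x) = Var x) by (intro x; apply (Edec (Var x))).
  assert (Edec_Fn : forall f l, dec (S (2 * cpair f l)) = Fn f (decl l)).
  { intros f l. rewrite (Hdecl l) at 1. now rewrite <- enc_Fn, Edec. }
  assert (Edecl_0 : decl 0 = []) by apply (Edecl []).
  assert (Edecl_S : forall u l, decl (S (cpair u l)) = dec u :: decl l).
  { intros u l. rewrite (Hdecl l), (Hdec u) at 1. apply (Edecl (dec u :: decl l)). }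
  destruct enumerate_substs as [sg Hsg].
  pose (lstep := fun l l' => exists ls u u' rs,
    l = ls ++ u :: rs /\ l' = ls ++ u' :: rs /\ rstep S' u u').
  destruct (tab_surj (fun i x y => match i with
    | 0 => chi (var_occ x (dec y))
    | 1 => chi (Exists (var_occ x) (decl y))
    | 2 => chi (exists rl R, x = enc_rule rl /\ y = enc_trs R /\ In rl R)
    | 3 => enc_term (subst (sg x) (dec y))
    | 4 => enc_list (map (subst (sg x)) (decl y))
    | 5 => chi (rstep S' (dec x) (dec y))
    | 6 => chi (lstep (decl x) (decl y))
    | 7 => enc_term (path x y)
    | _ => len x
    end)) as [al Hal].
  exists al. rewrite Hal. cbv zeta.
  match goal with |- context [occ_table ?G] => set (F := G) end.
  assert (Hroot : forall R s t, root_step R s t ->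
    root_code F (enc_trs R) (enc_term s) (enc_term t)).
  { intros R s t Hr. destruct (Hsg _ _ _ Hr) as (p & l & r & Hin & -> & ->).
    exists p, (enc_rule (l, r)), (enc_term l), (enc_term r). split; [reflexivity|].
    unfold F; simpl. rewrite Hchi, !Edec. split; [now exists (l, r), R|auto]. }
  split; [|split; [|split; [|split; [|split; [|split; [|split]]]]]]; auto.
  - split; [|split; [|split]].
    + intros x y. change (chi (var_occ x (dec (2 * y))) = 0 <-> x = y).
      rewrite Hchi, Edec_var. split; [now inversion 1|intros ->; constructor].
    + intros x f l w ->.
      change (chi (var_occ x (dec (S (2 * cpair f l)))) = 0 <-> chi (Exists (var_occ x) (decl l)) = 0).
      now rewrite !Hchi, Edec_Fn, var_occ_Fn.
    + intro x. unfold F; simpl. rewrite Hchi, Edecl_0, Exists_nil. auto.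
    + intros x u l w ->. unfold F; simpl. now rewrite !Hchi, Edecl_S, Exists_cons.
  - split.
    + intro a. unfold F; simpl. rewrite Hchi. intros (rl & [|r R] & _ & H & Hin); [easy|].
      now rewrite enc_trs_cons in H.
    + intros a b r w ->. unfold F; simpl. rewrite !Hchi. split.
      * intros (rl & [|r' R] & -> & H & Hin); [easy|].
        rewrite enc_trs_cons in H. injection H as H. apply cpair_inj in H.
        destruct H as [-> ->], Hin as [->|Hin]; [now left|right; eauto].
      * intros [->|(rl & R & -> & -> & Hin)].
        -- destruct (enc_trs_surj r) as [R ->]. destruct (cpair_surj b) as (l & r & ->).
           rewrite (Hdec l), (Hdec r). exists (dec l, dec r), ((dec l, dec r) :: R).
           unfold F; simpl. auto.
        -- destruct (cpair_surj b) as (l & r & ->). rewrite (Hdec l), (Hdec r).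
           exists rl, ((dec l, dec r) :: R). unfold F; simpl. auto.
  - split; [|split].
    + intros p f l w w' -> ->.
      change (enc_term (subst (sg p) (dec (S (2 * cpair f l)))) =
        S (2 * cpair f (enc_list (map (subst (sg p)) (decl l))))).
      now rewrite Edec_Fn.
    + intro p. unfold F; simpl. now rewrite Edecl_0.
    + intros p u l w w' -> ->. unfold F; simpl. now rewrite Edecl_S.
  - split.
    + intros s t. change (F 5 s t) with (chi (rstep S' (dec s) (dec t))).
      change (F 6) with (fun x y => chi (lstep (decl x) (decl y))). cbv beta.
      rewrite Hchi. intro H. rewrite (Hdec s), (Hdec t). inversion H as [a b Hr Ea Eb|f ls rs a b Hr Ea Eb].
      * left. subst a b. auto.
      * right. exists f, (enc_list (ls ++ a :: rs)), (enc_list (ls ++ b :: rs)).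
        do 2 eexists. do 2 (split; [reflexivity|]). rewrite !enc_Fn, Hchi, !Edecl.
        do 2 (split; [reflexivity|]). now exists ls, a, b, rs.
    + intros l l'.
      change (F 6) with (fun x y => chi (lstep (decl x) (decl y))).
      change (F 5) with (fun x y => chi (rstep S' (dec x) (dec y))). cbv beta.
      destruct (enc_list_surj l) as [k ->], (enc_list_surj l') as [k' ->].
      rewrite Hchi, !Edecl.
      intros ([|v ls] & u & u' & rs & -> & -> & Hu).
      * left. exists (enc_term u), (enc_term u'), (enc_list rs). do 2 eexists.
        do 4 (split; [reflexivity|]). now rewrite Hchi, !Edec.
      * right. exists (enc_term v), (enc_list (ls ++ u :: rs)), (enc_list (ls ++ u' :: rs)).
        do 2 eexists. do 4 (split; [reflexivity|]). rewrite Hchi, !Edecl. now exists ls, u, u', rs.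
  - intros s t H. unfold F; simpl. now rewrite Hchi, !Edec.
Qed.

Lemma red_table_complete R S' seq : (forall i, rel_step R S' (seq i) (seq (S i))) ->
  exists al, let F := tab al in
    occ_table F /\ in_table F /\ sub_table F /\ step_table F (enc_trs S') /\
    red_table F (enc_trs R) /\ F 7 0 0 = enc_term (seq 0).
Proof.
  intro H. destruct (rel_steps_paths _ _ _ H) as (path & len & H0 & Hs & Hr).
  destruct (tables_exist S' path len) as (al & HO & HI & HS & HT & H7 & H8 & Hroot & Hstep).
  exists al. cbv zeta in *. rewrite H7, H0. do 4 (split; [assumption|]). split; [|reflexivity].
  intro i. rewrite H8. split.
  - intros j Hj. rewrite !H7. auto.
  - rewrite !H7. auto.
Qed.

(** Guards against vacuity: well-formedness is asserted only under the assumption that the tables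
    are correct, so some correct tables must exist. *)
Lemma wf_tables_exist : exists al, occ_table (tab al) /\ in_table (tab al).
Proof.
  destruct (tables_exist [] (fun _ _ => Var 0) (fun _ => 0)) as (al & HO & HI & _).
  now exists al.
Qed.

Lemma Pi11_SNrel_triples : Pi11 SNrel_triples.
Proof.
  (* Well-formedness sits in the conclusion beside the negated reduction, so one universal function
     quantifier covers both. The codes [r], [s], [t] are unique because [cpair] is a bijection. *)
  assert (D : definable (fun al e => occ_table (tab al) -> in_table (tab al) ->
    forall m r s t, e 0 = cpair r m -> m = cpair s t ->
      (wf_code (tab al) r /\ wf_code (tab al) s) /\
      ~ (sub_table (tab al) /\ step_table (tab al) s /\ red_table (tab al) r /\
         tab al 7 0 0 = t))).
  { unfold occ_table, in_table, wf_code, sub_table, step_table, red_table, root_code, tab, qpair.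
    solve_definable. }
  destruct D as [phi Hphi]. exists phi. intro n.
  transitivity (forall al, occ_table (tab al) -> in_table (tab al) ->
    forall m r s t, n = cpair r m -> m = cpair s t ->
      (wf_code (tab al) r /\ wf_code (tab al) s) /\
      ~ (sub_table (tab al) /\ step_table (tab al) s /\ red_table (tab al) r /\
         tab al 7 0 0 = t)).
  2: { split; intros H al; specialize (H al); now apply (Hphi al (scons n (fun _ => 0))). }
  split.
  - intros (R & S' & t & HR & HS & -> & HSN) al HO HI m r s c E E'.
    apply cpair_inj in E. destruct E as [<- <-]. apply cpair_inj in E'. destruct E' as [<- <-].
    split; [split; now apply wf_code_spec|].
    intros (Hsub & Hst & Hred & H0). apply HSN.
    destruct (red_table_sound _ _ _ HI Hsub Hst Hred) as (seq & E & H).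
    exists seq. split; [|exact H]. apply enc_term_inj. congruence.
  - intro H. destruct (cpair_surj n) as (r & m & En), (cpair_surj m) as (s & c & Em).
    destruct (enc_trs_surj r) as [R ->], (enc_trs_surj s) as [S' ->], (enc_term_surj c) as [t ->].
    exists R, S', t. destruct wf_tables_exist as (al & HO & HI).
    destruct (H al HO HI _ _ _ _ En Em) as [[HR HS] _].
    split; [now apply (wf_code_spec (tab al))|]. split; [now apply (wf_code_spec (tab al))|].
    split; [congruence|].
    intros (seq & E & Hs). destruct (red_table_complete _ _ _ Hs) as (al' & Hal).
    cbv zeta in Hal. destruct Hal as (HO' & HI' & Hsub & Hst & Hred & H0).
    destruct (H al' HO' HI' _ _ _ _ En Em) as [_ K]. apply K. subst t. auto.
Qed.

Lemma Pi11_SNrel_pairs : Pi11 SNrel_pairs.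
Proof.
  (* The entry [tab al 7 0 0] is now unconstrained, so [al] also chooses the initial term. *)
  assert (D : definable (fun al e => occ_table (tab al) -> in_table (tab al) ->
    forall r s, e 0 = cpair r s ->
      (wf_code (tab al) r /\ wf_code (tab al) s) /\
      ~ (sub_table (tab al) /\ step_table (tab al) s /\ red_table (tab al) r))).
  { unfold occ_table, in_table, wf_code, sub_table, step_table, red_table, root_code, tab, qpair.
    solve_definable. }
  destruct D as [phi Hphi]. exists phi. intro n.
  transitivity (forall al, occ_table (tab al) -> in_table (tab al) ->
    forall r s, n = cpair r s ->
      (wf_code (tab al) r /\ wf_code (tab al) s) /\
      ~ (sub_table (tab al) /\ step_table (tab al) s /\ red_table (tab al) r)).
  2: { split; intros H al; specialize (H al); now apply (Hphi al (scons n (fun _ => 0))). }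
  split.
  - intros (R & S' & HR & HS & -> & HSN) al HO HI r s E.
    apply cpair_inj in E. destruct E as [<- <-].
    split; [split; now apply wf_code_spec|].
    intros (Hsub & Hst & Hred).
    destruct (red_table_sound _ _ _ HI Hsub Hst Hred) as (seq & E & H).
    apply (HSN (seq 0)). now exists seq.
  - intro H. destruct (cpair_surj n) as (r & s & En).
    destruct (enc_trs_surj r) as [R ->], (enc_trs_surj s) as [S' ->].
    exists R, S'. destruct wf_tables_exist as (al & HO & HI).
    destruct (H al HO HI _ _ En) as [[HR HS] _].
    split; [now apply (wf_code_spec (tab al))|]. split; [now apply (wf_code_spec (tab al))|].
    split; [congruence|].
    intros t (seq & E & Hs). destruct (red_table_complete _ _ _ Hs) as (al' & Hal).
    cbv zeta in Hal. destruct Hal as (HO' & HI' & Hsub & Hst & Hred & H0).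
    destruct (H al' HO' HI' _ _ En) as [_ K]. apply K. auto.
Qed.

(** * A normal form for Pi11 sets *)

Inductive bterm : Type :=
| BVar : nat -> bterm
| BZero : bterm
| BSucc : bterm -> bterm
| BPlus : bterm -> bterm -> bterm
| BMult : bterm -> bterm -> bterm
| BFun : bterm -> bterm
| BWit : bterm -> bterm.

Fixpoint beval (al be e : nat -> nat) (t : bterm) : nat :=
  match t with
  | BVar i => e i
  | BZero => 0
  | BSucc u => S (beval al be e u)
  | BPlus u w => beval al be e u + beval al be e w
  | BMult u w => beval al be e u * beval al be e w
  | BFun u => al (beval al be e u)
  | BWit u => be (beval al be e u)
  end.

(** Besides substituting for variables, it redirects every call of the witness function through [c];
    this is how several Skolem functions are packed into one. *)
Fixpoint bsub (v : nat -> bterm) (c : bterm -> bterm) (t : bterm) : bterm :=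
  match t with
  | BVar i => v i
  | BZero => BZero
  | BSucc u => BSucc (bsub v c u)
  | BPlus u w => BPlus (bsub v c u) (bsub v c w)
  | BMult u w => BMult (bsub v c u) (bsub v c w)
  | BFun u => BFun (bsub v c u)
  | BWit u => c (bsub v c u)
  end.

Lemma beval_bsub al be be' e e' v c t :
  (forall i, beval al be e (v i) = e' i) ->
  (forall u, beval al be e (c u) = be' (beval al be e u)) ->
  beval al be e (bsub v c t) = beval al be' e' t.
Proof.
  intros Hv Hc. induction t; simpl; rewrite ?Hv, ?Hc; congruence.
Qed.

(** Variable 0 is set aside for the universal quantifier of the normal form, hence the shift. *)
Fixpoint of_aterm (t : aterm) : bterm :=
  match t with
  | tvar i => BVar (S i)
  | tzero => BZero
  | tsucc u => BSucc (of_aterm u)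
  | tplus u w => BPlus (of_aterm u) (of_aterm w)
  | tmult u w => BMult (of_aterm u) (of_aterm w)
  | tapp u => BFun (of_aterm u)
  end.

Lemma beval_of_aterm al be x e t : beval al be (scons x e) (of_aterm t) = teval al e t.
Proof. induction t; simpl; congruence. Qed.

Fixpoint bnum (n : nat) : bterm :=
  match n with 0 => BZero | S n => BSucc (bnum n) end.

(* The matrix is a single equation between terms, with one universal number
   quantifier; be collects all Skolem functions. *)
Definition has_nf (P : (nat -> nat) -> (nat -> nat) -> Prop) : Prop :=
  exists s t, forall al e, P al e <->
    exists be, forall x, beval al be (scons x e) s = beval al be (scons x e) t.

(** This is [(a - b)^2 + (c - d)^2 = 0] with the mixed terms moved to the right; it turns a
    conjunction of two equations into one equation without subtraction. *)
Lemma sum_squares_eq a b c d :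
  a * a + b * b + (c * c + d * d) = 2 * a * b + 2 * c * d <-> a = b /\ c = d.
Proof.
  split; [|intros [-> ->]; lia]. intro H.
  destruct (Nat.le_ge_cases a b) as [H1|H1], (Nat.le_ge_cases c d) as [H2|H2];
    apply Nat.le_exists_sub in H1, H2; destruct H1 as (p & -> & _), H2 as (q & -> & _);
    assert (p * p + q * q = 0) by lia; nia.
Qed.

Definition band_l (s t s' t' : bterm) : bterm :=
  BPlus (BPlus (BMult s s) (BMult t t)) (BPlus (BMult s' s') (BMult t' t')).

Definition band_r (s t s' t' : bterm) : bterm :=
  BPlus (BMult (BMult (bnum 2) s) t) (BMult (BMult (bnum 2) s') t').

Lemma beval_band al be e s t s' t' :
  beval al be e (band_l s t s' t') = beval al be e (band_r s t s' t') <->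
  beval al be e s = beval al be e t /\ beval al be e s' = beval al be e t'.
Proof. rewrite <- sum_squares_eq. cbn -[Nat.mul Nat.add]. reflexivity. Qed.

Lemma has_nf_ext P Q : (forall al e, P al e <-> Q al e) -> has_nf P -> has_nf Q.
Proof. intros H (s & t & E). exists s, t. intros. now rewrite <- H. Qed.

(** The two Skolem functions live at the even and the odd arguments of one function, and the same
    [x] serves both equations. *)
Lemma has_nf_and P Q : has_nf P -> has_nf Q -> has_nf (fun al e => P al e /\ Q al e).
Proof.
  intros (s & t & H) (s' & t' & H').
  pose (c0 := fun u => BWit (BPlus u u)). pose (c1 := fun u => BWit (BSucc (BPlus u u))).
  exists (band_l (bsub BVar c0 s) (bsub BVar c0 t) (bsub BVar c1 s') (bsub BVar c1 t')).
  exists (band_r (bsub BVar c0 s) (bsub BVar c0 t) (bsub BVar c1 s') (bsub BVar c1 t')).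
  intros al e. rewrite H, H'. setoid_rewrite beval_band.
  assert (E0 : forall be e u, beval al be e (bsub BVar c0 u) = beval al (fun z => be (z + z)) e u)
    by (intros; now apply beval_bsub).
  assert (E1 : forall be e u, beval al be e (bsub BVar c1 u) = beval al (fun z => be (S (z + z))) e u)
    by (intros; now apply beval_bsub).
  setoid_rewrite E0. setoid_rewrite E1. split.
  - intros [[b Hb] [b' Hb']].
    destruct (graph_function (fun m v => exists z, m = z + z /\ v = b z \/ m = S (z + z) /\ v = b' z) 0)
      as [be Hbe].
    { intros m v v' [z Hz] [z' Hz']. assert (z = z') as <- by lia. lia. }
    exists be.
    replace (fun z => be (z + z)) with b
      by (apply functional_extensionality; intro z; symmetry; apply Hbe; exists z; auto).
    replace (fun z => be (S (z + z))) with b'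
      by (apply functional_extensionality; intro z; symmetry; apply Hbe; exists z; auto).
    auto.
  - intros [be Hbe]. split; eexists; intro x; apply Hbe.
Qed.

(** [be 0] holds the witness for [y], and the former Skolem function is shifted by one. *)
Lemma has_nf_ex (P : (nat -> nat) -> (nat -> nat) -> Prop) :
  has_nf P -> has_nf (fun al e => exists y, P al (scons y e)).
Proof.
  intros (s & t & H).
  pose (c := fun u => BWit (BSucc u)).
  pose (v := fun i => match i with 0 => BVar 0 | 1 => BWit BZero | S (S i) => BVar (S i) end).
  assert (E : forall al be x e u, beval al be (scons x e) (bsub v c u) =
    beval al (fun z => be (S z)) (scons x (scons (be 0) e)) u).
  { intros. apply beval_bsub; [|reflexivity]. now intros [|[|i]]. }
  exists (bsub v c s), (bsub v c t). intros al e. setoid_rewrite E. setoid_rewrite H. split.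
  - intros (y & b & Hb). exists (scons y b). exact Hb.
  - intros (be & Hbe). exists (be 0). eexists. exact Hbe.
Qed.

(* [be] stores an inverse of the pairing at 3z, 3z+1 and the witness for each y
   at 3 * qpair y k + 2. *)
Lemma has_nf_all (P : (nat -> nat) -> (nat -> nat) -> Prop) :
  has_nf P -> has_nf (fun al e => forall y, P al (scons y e)).
Proof.
  intros (s & t & H).
  pose (xt := BWit (BMult (bnum 3) (BVar 0))).
  pose (yt := BWit (BPlus (BMult (bnum 3) (BVar 0)) (bnum 1))).
  pose (c := fun u => BWit (BPlus (BMult (bnum 3)
    (BPlus (BMult (BPlus yt u) (BPlus yt u)) u)) (bnum 2))).
  pose (v := fun i => match i with 0 => xt | 1 => yt | S (S i) => BVar (S i) end).
  assert (E : forall al be x e u, beval al be (scons x e) (bsub v c u) =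
    beval al (fun z => be (3 * qpair (be (3 * x + 1)) z + 2))
      (scons (be (3 * x)) (scons (be (3 * x + 1)) e)) u).
  { intros. apply beval_bsub; [|reflexivity]. now intros [|[|i]]. }
  pose (pl := BMult (bnum 2) (BVar 0)).
  pose (pr := BPlus (BMult (BPlus xt yt) (BPlus (BPlus xt yt) (bnum 1))) (BMult (bnum 2) yt)).
  assert (Ep : forall al be x e, beval al be (scons x e) pl = beval al be (scons x e) pr <->
    x = cpair (be (3 * x)) (be (3 * x + 1))).
  { intros. rewrite eq_cpair_iff. reflexivity. }
  exists (band_l pl pr (bsub v c s) (bsub v c t)), (band_r pl pr (bsub v c s) (bsub v c t)).
  intros al e. setoid_rewrite beval_band. setoid_rewrite Ep. setoid_rewrite E.
  setoid_rewrite H. split.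
  - intro Hy. destruct (choice_fun _ Hy) as [b Hb].
    destruct (graph_function (fun m w => exists z a d,
      m = 3 * z /\ z = cpair a d /\ w = a \/
      m = 3 * z + 1 /\ z = cpair a d /\ w = d \/
      m = 3 * qpair a d + 2 /\ w = b a d) 0) as [be Hbe].
    { intros m w w' (z & a & d & Hz) (z' & a' & d' & Hz').
      destruct Hz as [(-> & -> & ->)|[(-> & -> & ->)|(-> & ->)]],
        Hz' as [(E1 & -> & ->)|[(E1 & -> & ->)|(E1 & ->)]]; try lia.
      - assert (E2 : cpair a d = cpair a' d') by lia. now apply cpair_inj in E2.
      - assert (E2 : cpair a d = cpair a' d') by lia. now apply cpair_inj in E2.
      - assert (E2 : qpair a d = qpair a' d') by lia. apply qpair_inj in E2.
        now destruct E2 as [-> ->]. }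
    exists be. intro x. destruct (cpair_surj x) as (a & d & ->).
    assert (E0 : be (3 * cpair a d) = a) by (apply Hbe; exists (cpair a d), a, d; auto).
    assert (E1 : be (3 * cpair a d + 1) = d) by (apply Hbe; exists (cpair a d), a, d; auto).
    rewrite E0, E1. split; [reflexivity|].
    replace (fun z => be (3 * qpair d z + 2)) with (b d); [apply Hb|].
    apply functional_extensionality; intro z. symmetry. apply Hbe. exists 0, d, z. auto.
  - intros [be Hbe] y. exists (fun z => be (3 * qpair y z + 2)). intro x.
    destruct (Hbe (cpair x y)) as [Hx Hx']. apply cpair_inj in Hx. destruct Hx as [E1 E2].
    now rewrite <- E1, <- E2 in Hx'.
Qed.

Lemma has_nf_eq u w : has_nf (fun al e => teval al e u = teval al e w).
Proof.
  exists (of_aterm u), (of_aterm w). intros. setoid_rewrite beval_of_aterm.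
  split; [intro H; now exists (fun _ => 0)|intros [_ H]; exact (H 0)].
Qed.

Lemma has_nf_lt u w : has_nf (fun al e => teval al e u < teval al e w).
Proof.
  exists (BSucc (BPlus (of_aterm u) (BWit BZero))), (of_aterm w). intros al e.
  cbn [beval]. setoid_rewrite beval_of_aterm. split.
  - intro H. exists (fun _ => teval al e w - S (teval al e u)). lia.
  - intros [be H]. specialize (H 0). lia.
Qed.

Lemma has_nf_not_lt u w : has_nf (fun al e => ~ teval al e u < teval al e w).
Proof.
  exists (BPlus (of_aterm w) (BWit BZero)), (of_aterm u). intros al e.
  cbn [beval]. setoid_rewrite beval_of_aterm. split.
  - intro H. exists (fun _ => teval al e u - teval al e w). lia.
  - intros [be H]. specialize (H 0). lia.
Qed.

(* The witnesses be 0 and be 1 have sum 1 and select the disjunct. *)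
Lemma has_nf_or P Q : has_nf P -> has_nf Q -> has_nf (fun al e => P al e \/ Q al e).
Proof.
  intros (s & t & H) (s' & t' & H').
  pose (f := BWit BZero). pose (g := BWit (bnum 1)).
  pose (c0 := fun u => BWit (BPlus (BPlus u u) (bnum 2))).
  pose (c1 := fun u => BWit (BPlus (BPlus u u) (bnum 3))).
  pose (lhs := BPlus (BMult f (bsub BVar c0 s)) (BMult g (bsub BVar c1 s'))).
  pose (rhs := BPlus (BMult f (bsub BVar c0 t)) (BMult g (bsub BVar c1 t'))).
  exists (band_l (BPlus f g) (bnum 1) lhs rhs), (band_r (BPlus f g) (bnum 1) lhs rhs).
  intros al e. rewrite H, H'. setoid_rewrite beval_band. unfold lhs, rhs. cbn [beval f g bnum].
  assert (E0 : forall be e u, beval al be e (bsub BVar c0 u) = beval al (fun z => be (z + z + 2)) e u)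
    by (intros; now apply beval_bsub).
  assert (E1 : forall be e u, beval al be e (bsub BVar c1 u) = beval al (fun z => be (z + z + 3)) e u)
    by (intros; now apply beval_bsub).
  setoid_rewrite E0. setoid_rewrite E1.
  assert (Hj : forall k0 k1 (b b' : nat -> nat), exists be, be 0 = k0 /\ be 1 = k1 /\
    (fun z => be (z + z + 2)) = b /\ (fun z => be (z + z + 3)) = b').
  { intros k0 k1 b b'.
    destruct (graph_function (fun m v => m = 0 /\ v = k0 \/ m = 1 /\ v = k1 \/
      exists z, m = z + z + 2 /\ v = b z \/ m = z + z + 3 /\ v = b' z) 0) as [be Hbe].
    { intros m v v' [Hz|[Hz|[z Hz]]] [Hz'|[Hz'|[z' Hz']]]; try lia.
      assert (z = z') as <- by lia. lia. }
    exists be. split; [|split; [|split]]; try (apply functional_extensionality; intro z);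
      apply Hbe; eauto 6. }
  split.
  - intros [[b Hb]|[b Hb]].
    + destruct (Hj 1 0 b b) as (be & K0 & K1 & K2 & K3).
      exists be. rewrite K0, K1, K2, K3. intro x. rewrite Hb. lia.
    + destruct (Hj 0 1 b b) as (be & K0 & K1 & K2 & K3).
      exists be. rewrite K0, K1, K2, K3. intro x. rewrite Hb. lia.
  - intros [be Hbe]. destruct (Hbe 0) as [Hf _].
    destruct (be 0) as [|k] eqn:K0; [right|left]; eexists; intro x; destruct (Hbe x) as [_ Hx].
    + assert (K1 : be 1 = 1) by lia. rewrite K1 in Hx. rewrite !Nat.mul_0_l, !Nat.mul_1_l in Hx.
      exact Hx.
    + assert (K1 : be 1 = 0) by lia. assert (K : k = 0) by lia.
      rewrite K1, K, !Nat.mul_0_l, !Nat.mul_1_l, !Nat.add_0_r in Hx. exact Hx.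
Qed.

(** The shape of a normal form is not visibly closed under negation, as it begins with a function
    quantifier. Treating a formula together with its negation pushes negations down to the atoms. *)
Lemma has_nf_sat phi :
  has_nf (fun al e => sat al e phi) /\ has_nf (fun al e => ~ sat al e phi).
Proof.
  induction phi as [u w|u w|p [IH1 IH2]|p [IHp1 IHp2] q [IHq1 IHq2]|p [IHp1 IHp2] q [IHq1 IHq2]
    |p [IHp1 IHp2] q [IHq1 IHq2]|p [IH1 IH2]|p [IH1 IH2]]; simpl; split.
  - apply has_nf_eq.
  - eapply has_nf_ext; [|apply (has_nf_or _ _ (has_nf_lt u w) (has_nf_lt w u))].
    intros. simpl. lia.
  - apply has_nf_lt.
  - apply has_nf_not_lt.
  - exact IH2.
  - eapply has_nf_ext; [|exact IH1]. intros. simpl. tauto.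
  - now apply has_nf_and.
  - eapply has_nf_ext; [|apply (has_nf_or _ _ IHp2 IHq2)]. intros. simpl. tauto.
  - now apply has_nf_or.
  - eapply has_nf_ext; [|apply (has_nf_and _ _ IHp2 IHq2)]. intros. simpl. tauto.
  - eapply has_nf_ext; [|apply (has_nf_or _ _ IHp2 IHq1)]. intros. simpl. tauto.
  - eapply has_nf_ext; [|apply (has_nf_and _ _ IHp1 IHq2)]. intros. simpl. tauto.
  - now apply has_nf_all in IH1.
  - eapply has_nf_ext; [|apply (has_nf_ex _ IH2)]. intros al e. simpl. split.
    + intros [x H] K. now apply H.
    + intro H. now apply not_all_ex_not in H.
  - now apply has_nf_ex in IH1.
  - eapply has_nf_ext; [|apply (has_nf_all _ IH2)]. intros al e. simpl. split.
    + intros H [x K]. now apply (H x).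
    + intros H x K. apply H. now exists x.
Qed.

(** The function parameter sits at the even arguments of [ga] and the Skolem function at the odd
    ones, the layout that [code] uses for its lookups. *)
Definition side (n : nat) (ga : nat -> nat) (x : nat) (t : bterm) : nat :=
  beval (fun z => ga (z + z)) (fun z => ga (S (z + z))) (scons x (scons n (fun _ => 0))) t.

Lemma Pi11_normal_form A : Pi11 A ->
  exists s t, forall n, A n <-> ~ exists ga, forall x, side n ga x s = side n ga x t.
Proof.
  intros [phi Hphi]. destruct (has_nf_sat phi) as [_ (s & t & H)]. exists s, t. intro n.
  unfold side.
  rewrite Hphi. split.
  - intros HA [ga Hga]. set (al := fun z => ga (z + z)) in *.
    apply (proj2 (H al (scons n (fun _ => 0)))); [eexists; exact Hga|apply HA].
  - intros HN al. apply NNPP. intro K. apply (H al) in K. destruct K as [be K].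
    apply HN.
    destruct (graph_function (fun m v => exists z, m = z + z /\ v = al z \/ m = S (z + z) /\ v = be z) 0)
      as [ga Hga].
    { intros m v v' [z Hz] [z' Hz']. assert (z = z') as <- by lia. lia. }
    exists ga.
    replace (fun z => ga (z + z)) with al
      by (apply functional_extensionality; intro z; symmetry; apply Hga; exists z; auto).
    replace (fun z => ga (S (z + z))) with be
      by (apply functional_extensionality; intro z; symmetry; apply Hga; exists z; auto).
    exact K.
Qed.

(** * The rewrite system *)

(* The numbering is a rank: every rule decreases the root symbol, except the two
   rules for sRun and sTest. *)
Notation sZero := 0 (only parsing).
Notation sSucc := 1 (only parsing).
Notation sNil := 2 (only parsing).
Notation sCons := 3 (only parsing).
Notation sOk := 4 (only parsing).
Notation sCopy := 5 (only parsing).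
Notation sAdd := 6 (only parsing).
Notation sMul := 7 (only parsing).
Notation sGet := 8 (only parsing).
Notation sInput := 9 (only parsing).
Notation sEq := 10 (only parsing).
Notation sCheck := 11 (only parsing).
Notation sNumS := 12 (only parsing).
Notation sNorm := 13 (only parsing).
Notation sPick := 14 (only parsing).
Notation sListC := 15 (only parsing).
Notation sNew := 16 (only parsing).
Notation sExt := 17 (only parsing).
Notation sRun := 18 (only parsing).
Notation sTest := 19 (only parsing).

Notation "0'" := (Fn sZero []).
Notation sc t := (Fn sSucc [t]).

Fixpoint num (n : nat) : term :=
  match n with 0 => 0' | S n => sc (num n) end.

Fixpoint lst (l : list nat) : term :=
  match l with [] => Fn sNil [] | a :: l => Fn sCons [num a; lst l] end.

(* [BVar 1] is the parameter of the reduced set, produced by the rule for sInput. *)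
Fixpoint code (l x : term) (t : bterm) : term :=
  match t with
  | BVar 0 => x
  | BVar 1 => Fn sInput []
  | BVar _ => 0'
  | BZero => 0'
  | BSucc u => sc (code l x u)
  | BPlus u w => Fn sAdd [code l x u; code l x w]
  | BMult u w => Fn sMul [code l x u; code l x w]
  | BFun u => Fn sGet [l; Fn sAdd [code l x u; code l x u]]
  | BWit u => Fn sGet [l; sc (Fn sAdd [code l x u; code l x u])]
  end.

Definition eq_code (l x : term) (p q : bterm) : term :=
  Fn sEq [code l x p; code l x q].

Notation v0 := (Var 0) (only parsing).
Notation v1 := (Var 1) (only parsing).

(** Recursive calls that would not lower the root symbol are placed below [sCopy], [sAdd], [sNumS],
    [sListC] or a constructor. The marker [sOk] enforces call by value: [sRun] fires only when both
    generators have delivered. Sums act as conjunctions, since 0 stands for truth in [sEq] and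
    [sCheck]. *)
Definition base (p q : bterm) : trs :=
  [ (Fn sCopy [0'], 0');
    (Fn sCopy [sc v0], sc (Fn sCopy [v0]));
    (Fn sAdd [0'; v0], Fn sCopy [v0]);
    (Fn sAdd [sc v0; v1], sc (Fn sAdd [v0; v1]));
    (Fn sMul [0'; v0], 0');
    (Fn sMul [sc v0; v1], Fn sAdd [v1; Fn sMul [v0; v1]]);
    (Fn sGet [Fn sCons [v0; v1]; 0'], Fn sCopy [v0]);
    (Fn sGet [Fn sCons [v0; v1]; sc (Var 2)], Fn sCopy [Fn sGet [v1; Var 2]]);
    (Fn sEq [0'; 0'], 0');
    (Fn sEq [sc v0; sc v1], Fn sCopy [Fn sEq [v0; v1]]);
    (Fn sCheck [v0; 0'], eq_code v0 0' p q);
    (Fn sCheck [v0; sc v1], Fn sAdd [Fn sCheck [v0; v1]; eq_code v0 (sc v1) p q]);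
    (Fn sNumS [Fn sOk [v0]], Fn sOk [sc v0]);
    (Fn sNorm [0'], Fn sOk [0']);
    (Fn sNorm [sc v0], Fn sNumS [Fn sNorm [v0]]);
    (Fn sPick [], Fn sOk [0']);
    (Fn sPick [], Fn sNumS [Fn sPick []]);
    (Fn sListC [Fn sOk [v0]; Fn sOk [v1]], Fn sOk [Fn sCons [v0; v1]]);
    (Fn sNew [], Fn sOk [Fn sNil []]);
    (Fn sNew [], Fn sListC [Fn sPick []; Fn sNew []]);
    (Fn sExt [Fn sNil []], Fn sNew []);
    (Fn sExt [Fn sCons [v0; v1]], Fn sListC [Fn sNorm [v0]; Fn sExt [v1]]);
    (Fn sRun [Fn sOk [v0]; Fn sOk [v1]], Fn sTest [v0; v1; Fn sCheck [v0; v1]]);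
    (Fn sTest [v0; v1; 0'], Fn sRun [Fn sExt [v0]; Fn sNumS [Fn sNorm [v1]]]) ].

(** Only the head rule depends on [n], through a numeral on its right, so the code of [base p q] is
    a constant of the reduction function. *)
Definition sys (n : nat) (p q : bterm) : trs := (Fn sInput [], num n) :: base p q.

Definition start : term := Fn sRun [Fn sNew []; Fn sOk [0']].

Inductive rt (n : nat) (p q : bterm) : term -> term -> Prop :=
| rt_input : rt n p q (Fn sInput []) (num n)
| rt_copy0 : rt n p q (Fn sCopy [0']) 0'
| rt_copyS x : rt n p q (Fn sCopy [sc x]) (sc (Fn sCopy [x]))
| rt_add0 x : rt n p q (Fn sAdd [0'; x]) (Fn sCopy [x])
| rt_addS x y : rt n p q (Fn sAdd [sc x; y]) (sc (Fn sAdd [x; y]))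
| rt_mul0 x : rt n p q (Fn sMul [0'; x]) 0'
| rt_mulS x y : rt n p q (Fn sMul [sc x; y]) (Fn sAdd [y; Fn sMul [x; y]])
| rt_get0 a l : rt n p q (Fn sGet [Fn sCons [a; l]; 0']) (Fn sCopy [a])
| rt_getS a l i : rt n p q (Fn sGet [Fn sCons [a; l]; sc i]) (Fn sCopy [Fn sGet [l; i]])
| rt_eq0 : rt n p q (Fn sEq [0'; 0']) 0'
| rt_eqS x y : rt n p q (Fn sEq [sc x; sc y]) (Fn sCopy [Fn sEq [x; y]])
| rt_check0 l : rt n p q (Fn sCheck [l; 0']) (eq_code l 0' p q)
| rt_checkS l x : rt n p q (Fn sCheck [l; sc x])
    (Fn sAdd [Fn sCheck [l; x]; eq_code l (sc x) p q])
| rt_numS x : rt n p q (Fn sNumS [Fn sOk [x]]) (Fn sOk [sc x])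
| rt_norm0 : rt n p q (Fn sNorm [0']) (Fn sOk [0'])
| rt_normS x : rt n p q (Fn sNorm [sc x]) (Fn sNumS [Fn sNorm [x]])
| rt_pick0 : rt n p q (Fn sPick []) (Fn sOk [0'])
| rt_pickS : rt n p q (Fn sPick []) (Fn sNumS [Fn sPick []])
| rt_listC a l : rt n p q (Fn sListC [Fn sOk [a]; Fn sOk [l]]) (Fn sOk [Fn sCons [a; l]])
| rt_new0 : rt n p q (Fn sNew []) (Fn sOk [Fn sNil []])
| rt_newS : rt n p q (Fn sNew []) (Fn sListC [Fn sPick []; Fn sNew []])
| rt_ext0 : rt n p q (Fn sExt [Fn sNil []]) (Fn sNew [])
| rt_extS a l : rt n p q (Fn sExt [Fn sCons [a; l]]) (Fn sListC [Fn sNorm [a]; Fn sExt [l]])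
| rt_run l x : rt n p q (Fn sRun [Fn sOk [l]; Fn sOk [x]]) (Fn sTest [l; x; Fn sCheck [l; x]])
| rt_test l x : rt n p q (Fn sTest [l; x; 0']) (Fn sRun [Fn sExt [l]; Fn sNumS [Fn sNorm [x]]]).

Lemma subst_num sg n : subst sg (num n) = num n.
Proof. induction n as [|n IH]; simpl; [reflexivity|now rewrite IH]. Qed.

Lemma subst_code sg l x t : subst sg (code l x t) = code (subst sg l) (subst sg x) t.
Proof. induction t as [[|[|i]]| | | | | |]; simpl; congruence. Qed.

Lemma root_step_rt n p q s t : root_step (sys n p q) s t <-> rt n p q s t.
Proof.
  split.
  - intros (l & r & sg & Hin & -> & ->).
    unfold sys, base in Hin. cbn [In] in Hin.
    repeat (destruct Hin as [Hin|Hin];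
      [injection Hin as <- <-; unfold eq_code; cbn [subst map];
       rewrite ?subst_num, ?subst_code; constructor|]).
    destruct Hin.
  - intro H.
    pose (sg := fun a b c i => match i with 0 => a | 1 => b | _ => c end : term).
    assert (K : exists rl a b c, In rl (sys n p q) /\ s = subst (sg a b c) (fst rl) /\
      t = subst (sg a b c) (snd rl)).
    { unfold sys, base. destruct H;
      match goal with
      | |- context [In _ ?L] =>
        let rec try_rules L :=
          lazymatch L with
          | ?r :: ?L' => first [
             (exists r; do 3 eexists; split; [simpl; tauto|];
             unfold eq_code; cbn [fst snd subst map sg]; rewrite ?subst_num, ?subst_code;
             cbn [subst map sg]; split; reflexivity) | try_rules L' ]
          end in try_rules L
      end. }
    destruct K as ([l r] & a & b & c & Hin & -> & ->). now exists l, r, (sg a b c).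
    Unshelve. all: exact 0'.
Qed.

Lemma rstep_Fn_inv n p q f ts t : rstep (sys n p q) (Fn f ts) t ->
  rt n p q (Fn f ts) t \/
  exists ls s u rs, ts = ls ++ s :: rs /\ t = Fn f (ls ++ u :: rs) /\ rstep (sys n p q) s u.
Proof.
  intro H. inversion H as [a b Hr Ea Eb|g ls rs a b Hr Ea Eb].
  - left. now apply root_step_rt.
  - right. now exists ls, a, b, rs.
Qed.

(** * Soundness *)

Definition prefix (P Q : list nat) : Prop := exists M, Q = P ++ M.

Lemma prefix_refl P : prefix P P.
Proof. exists []. now rewrite app_nil_r. Qed.

Lemma prefix_trans P Q M : prefix P Q -> prefix Q M -> prefix P M.
Proof. intros [A ->] [B ->]. exists (A ++ B). now rewrite app_assoc. Qed.

Definition agrees (P : list nat) (ga : nat -> nat) : Prop :=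
  forall m, m < length P -> nth m P 0 = ga m.

Definition holds (n : nat) (p q : bterm) (ga : nat -> nat) (x : nat) : Prop :=
  side n ga x p = side n ga x q.

Definition defect (n : nat) (p q : bterm) (ga : nat -> nat) (x : nat) : nat :=
  if side n ga x p =? side n ga x q then 0 else 1.

Fixpoint total_defect (n : nat) (p q : bterm) (ga : nat -> nat) (j : nat) : nat :=
  match j with
  | 0 => defect n p q ga 0
  | S i => total_defect n p q ga i + defect n p q ga (S i)
  end.

Lemma total_defect_0 n p q ga j :
  total_defect n p q ga j = 0 -> forall y, y <= j -> holds n p q ga y.
Proof.
  assert (K : forall x, defect n p q ga x = 0 -> holds n p q ga x).
  { intros x. unfold defect, holds. now destruct (Nat.eqb_spec (side n ga x p) (side n ga x q)). }
  induction j as [|j IH]; simpl; intros H y Hy.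
  - apply K. now replace y with 0 by lia.
  - destruct (Nat.eq_dec y (S j)) as [->|]; [apply K; lia|apply IH; lia].
Qed.

Ltac split_args :=
  match goal with
  | H : _ = ?ls ++ ?s :: ?rs |- _ =>
    first [ destruct ls; discriminate H
          | let E := fresh in
            destruct ls as [|? ls]; simpl in H;
            [injection H as E H; try subst s; try subst rs
            |injection H as E H; subst; split_args] ]
  end.

Ltac step_cases H :=
  apply rstep_Fn_inv in H; destruct H as [H|(? & ? & ? & ? & ? & ? & H)];
  [inversion H; subst; clear H|subst; split_args; simpl].

Ltac split_data :=
  match goal with
  | H : Fn _ _ = num ?v |- _ =>
    destruct v; [try discriminate H|try discriminate H; injection H as H; try subst]
  | H : Fn _ _ = lst ?Q |- _ =>
    destruct Q as [|? ?]; [try discriminate H|try discriminate H; injection H as ?H ?H; subst]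
  end.

Lemma num_normal n p q k t : ~ rstep (sys n p q) (num k) t.
Proof.
  revert t. induction k as [|k IH]; intros t H; simpl in H; step_cases H. now apply IH in H.
Qed.

Lemma lst_normal n p q l t : ~ rstep (sys n p q) (lst l) t.
Proof.
  revert t. induction l as [|a l IH]; intros t H; simpl in H; step_cases H.
  - now apply num_normal in H.
  - now apply IH in H.
Qed.

(* Call-by-value denotation with respect to the function of which all lists are
   segments; junk arguments have no denotation. *)
Inductive den (n : nat) (p q : bterm) (ga : nat -> nat) : term -> nat -> Prop :=
| den_zero : den n p q ga 0' 0
| den_succ t v : den n p q ga t v -> den n p q ga (sc t) (S v)
| den_copy t v : den n p q ga t v -> den n p q ga (Fn sCopy [t]) v
| den_add t u a b : den n p q ga t a -> den n p q ga u b ->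
    den n p q ga (Fn sAdd [t; u]) (a + b)
| den_mul t u a b : den n p q ga t a -> den n p q ga u b ->
    den n p q ga (Fn sMul [t; u]) (a * b)
| den_get Q k t i : (forall m, m < length Q -> nth m Q 0 = ga (k + m)) -> den n p q ga t i ->
    den n p q ga (Fn sGet [lst Q; t]) (ga (k + i))
| den_input : den n p q ga (Fn sInput []) n
| den_eq t u a b : den n p q ga t a -> den n p q ga u b ->
    den n p q ga (Fn sEq [t; u]) (if a =? b then 0 else 1)
| den_check Q t j : agrees Q ga -> den n p q ga t j ->
    den n p q ga (Fn sCheck [lst Q; t]) (total_defect n p q ga j).

Lemma den_num n p q ga k : den n p q ga (num k) k.
Proof. induction k; simpl; now constructor. Qed.

Lemma den_code n p q ga Q x v t : agrees Q ga -> den n p q ga x v ->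
  den n p q ga (code (lst Q) x t) (side n ga v t).
Proof.
  unfold side. intros HQ Hx. induction t as [[|[|i]]| | | | |u IH|u IH]; simpl; try assumption; try now constructor.
  - exact (den_get n p q ga Q 0 _ _ HQ (den_add _ _ _ _ _ _ _ _ IH IH)).
  - exact (den_get n p q ga Q 0 _ _ HQ (den_succ _ _ _ _ _ _ (den_add _ _ _ _ _ _ _ _ IH IH))).
Qed.

Lemma den_eq_code n p q ga Q x v : agrees Q ga -> den n p q ga x v ->
  den n p q ga (eq_code (lst Q) x p q) (defect n p q ga v).
Proof. intros. unfold eq_code, defect. constructor; now apply den_code. Qed.

(** Denotations ignore the length of a list; past its end no rule for [sGet] applies, so the value
    [ga (k + i)] is never contradicted. *)
Lemma den_step n p q ga t v t' :
  den n p q ga t v -> rstep (sys n p q) t t' -> den n p q ga t' v.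
Proof.
  intro H. revert t'. induction H as [|t v Ht IH|t v Ht IH|t u a b Ht IHt Hu IHu
    |t u a b Ht IHt Hu IHu|Q k t i HQ Ht IH| |t u a b Ht IHt Hu IHu|Q t j HQ Ht IH];
    intros t' Hs; step_cases Hs.
  all: try (constructor; auto; fail).
  all: try (now apply lst_normal in Hs).
  - assumption.
  - inversion Ht; subst. now repeat constructor.
  - inversion Ht; subst. now repeat constructor.
  - inversion Ht; subst. simpl. now repeat constructor.
  - inversion Ht; subst. constructor.
  - inversion Ht; subst. simpl. now repeat constructor.
  - split_data. inversion Ht; subst.
    rewrite <- (HQ 0) by (simpl; lia). constructor. apply den_num.
  (* Dropping the head of the list moves the offset by one, which is why [den_get] carries [k]. *)
  - split_data. inversion Ht; subst.
    rewrite <- Nat.add_succ_comm. constructor. constructor; [|assumption].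
    intros m Hm. rewrite Nat.add_succ_comm. apply (HQ (S m)). simpl. lia.
  - apply den_num.
  - inversion Ht; inversion Hu; subst. constructor.
  - inversion Ht; inversion Hu; subst. simpl. now repeat constructor.
  - inversion Ht; subst. now apply den_eq_code.
  - inversion Ht; subst. simpl. constructor; [now constructor|now apply den_eq_code].
Qed.

Lemma check_sound n p q ga Q j : agrees Q ga ->
  clos_refl_trans term (rstep (sys n p q)) (Fn sCheck [lst Q; num j]) 0' ->
  forall y, y <= j -> holds n p q ga y.
Proof.
  intros HQ H. apply total_defect_0.
  assert (K : den n p q ga 0' (total_defect n p q ga j)); [|now inversion K].
  apply clos_rt_rtn1 in H. induction H as [|t u Hs _ IH].
  - constructor; [exact HQ|apply den_num].
  - eapply den_step; eauto.
Qed.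

(* [gen_num A t] and [gen_list B t]: whatever t is rewritten to, a result [Fn sOk [u]]
   has for u a numeral in A (a list in B).  Fresh results are proper data even when
   the arguments of sNorm and sExt are junk. *)
Inductive gen_num : (nat -> Prop) -> term -> Prop :=
| gn_any (A : nat -> Prop) t : (forall v, A v) -> gen_num A (Fn sNorm [t])
| gn_norm (A : nat -> Prop) v : A v -> gen_num A (Fn sNorm [num v])
| gn_pick (A : nat -> Prop) : (forall v, A v) -> gen_num A (Fn sPick [])
| gn_succ (A : nat -> Prop) t : gen_num (fun v => A (S v)) t -> gen_num A (Fn sNumS [t])
| gn_ok (A : nat -> Prop) v : A v -> gen_num A (Fn sOk [num v]).

Inductive gen_list : (list nat -> Prop) -> term -> Prop :=
| gl_any (B : list nat -> Prop) t : (forall l, B l) -> gen_list B (Fn sExt [t])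
| gl_ext (B : list nat -> Prop) Q : (forall M, B (Q ++ M)) -> gen_list B (Fn sExt [lst Q])
| gl_new (B : list nat -> Prop) : (forall l, B l) -> gen_list B (Fn sNew [])
| gl_cons (A : nat -> Prop) (B' B : list nat -> Prop) g t :
    gen_num A g -> gen_list B' t -> (forall a l, A a -> B' l -> B (a :: l)) ->
    gen_list B (Fn sListC [g; t])
| gl_ok (B : list nat -> Prop) Q : B Q -> gen_list B (Fn sOk [lst Q]).

Lemma gen_num_step n p q A t t' : gen_num A t -> rstep (sys n p q) t t' -> gen_num A t'.
Proof.
  intro H. revert t'.
  induction H as [A t HA|A v HA|A HA|A t Ht IH|A v HA]; intros t' Hs; step_cases Hs.
  - now apply (gn_ok A 0).
  - constructor. now constructor.
  - now constructor.
  - split_data. now apply (gn_ok A 0).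
  - split_data. constructor. now constructor.
  - now apply num_normal in Hs.
  - now apply (gn_ok A 0).
  - constructor. now constructor.
  - inversion Ht; subst. now apply (gn_ok A (S v)).
  - constructor. now apply IH.
  - now apply num_normal in Hs.
Qed.

Lemma gen_list_step n p q B t t' : gen_list B t -> rstep (sys n p q) t t' -> gen_list B t'.
Proof.
  intro H. revert t'.
  induction H as [B t HB|B Q HB|B HB|A B' B g t Hg Ht IH HB|B Q HB]; intros t' Hs; step_cases Hs.
  - now constructor.
  - apply (gl_cons (fun _ => True) (fun _ => True)); try constructor; auto.
  - now constructor.
  - split_data. now constructor.
  (* The copied head is pinned by [eq], and the tail inherits the rest of the constraint on the
     whole list. *)
  - split_data. eapply (gl_cons (eq _) (fun l => B (_ :: l))).
    + now constructor.
    + apply gl_ext. exact HB.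
    + now intros a l <-.
  - now apply lst_normal in Hs.
  - now apply (gl_ok B []).
  - apply (gl_cons (fun _ => True) (fun _ => True)); try constructor; auto.
  - inversion Hg; inversion Ht; subst. apply (gl_ok B (v :: Q)). auto.
  - eapply gl_cons; eauto using gen_num_step.
  - eapply gl_cons; eauto.
  - now apply lst_normal in Hs.
Qed.

(** * The main loop and its invariant *)

Record state := { known : list nat; stage : nat; testing : bool }.

(** The stage advances only in every second root step of the loop; counting the phase too gives a
    quantity that grows with each of them. *)
Definition clock (st : state) : nat := 2 * stage st + (if testing st then 1 else 0).

(** The equations below the stage hold for every function extending the known segment, so later
    guesses cannot invalidate them. While guessing, results must extend the segment and reach the
    stage; while testing, list and number are fixed and only the check evolves. The number is merely
    bounded below, as its initial value may come from junk. *)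
Definition inv (n : nat) (p q : bterm) (st : state) (t : term) : Prop :=
  (forall ga y, agrees (known st) ga -> y < stage st -> holds n p q ga y) /\
  if testing st then
    exists Q j c, t = Fn sTest [lst Q; num j; c] /\ prefix (known st) Q /\ stage st <= j /\
      clos_refl_trans term (rstep (sys n p q)) (Fn sCheck [lst Q; num j]) c
  else
    exists g h, t = Fn sRun [g; h] /\ gen_list (prefix (known st)) g /\ gen_num (le (stage st)) h.

Lemma inv_root n p q st t t' : inv n p q st t -> root_step (sys n p q) t t' ->
  exists st', inv n p q st' t' /\ prefix (known st) (known st') /\ clock st < clock st'.
Proof.
  intros [Hp H] Hr. apply root_step_rt in Hr. destruct st as [P k [|]]; simpl in *.
  - destruct H as (Q & j & c & -> & HQ & Hk & Hc). inversion Hr; subst.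
    (* The completed check covers all [y <= j] for every function extending [Q], and [k <= j]; so
       [Q] becomes known and the stage rises by one. *)
    exists {| known := Q; stage := S k; testing := false |}. unfold inv, clock; simpl.
    split; [split|split; [assumption|lia]].
    + intros ga y Hga Hy. apply (check_sound n p q ga Q j Hga Hc). lia.
    + do 2 eexists. split; [reflexivity|]. split.
      * apply gl_ext. intro M. now exists M.
      * apply gn_succ, gn_norm. lia.
  - destruct H as (g & h & -> & Hg & Hh). inversion Hr; subst. inversion Hg; inversion Hh; subst.
    exists {| known := P; stage := k; testing := true |}. unfold inv, clock; simpl.
    split; [split|split; [apply prefix_refl|lia]]; [assumption|].
    do 3 eexists. split; [reflexivity|]. repeat split; auto. apply rt_refl.
Qed.

Lemma inv_step n p q st t t' : inv n p q st t -> rstep (sys n p q) t t' ->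
  exists st', inv n p q st' t' /\ prefix (known st) (known st') /\ clock st <= clock st'.
Proof.
  intros H Hs. inversion Hs as [a b Hr Ea Eb|f ls rs a b Hr Ea Eb].
  - subst a b. destruct (inv_root _ _ _ _ _ _ H Hr) as (st' & H1 & H2 & H3).
    exists st'. auto with arith.
  - exists st. split; [|split; [apply prefix_refl|lia]].
    destruct H as [Hp H]. split; [exact Hp|]. destruct (testing st).
    + destruct H as (Q & j & c & Et & HQ & Hk & Hc). rewrite <- Ea in Et. injection Et as -> Et.
      symmetry in Et. split_args; simpl.
      * now apply lst_normal in Hr.
      * now apply num_normal in Hr.
      * do 3 eexists. split; [reflexivity|]. repeat split; auto.
        eapply rt_trans; [exact Hc|now apply rt_step].
    + destruct H as (g & h & Et & Hg & Hh). rewrite <- Ea in Et. injection Et as -> Et.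
      symmetry in Et. split_args; simpl; do 2 eexists; (split; [reflexivity|]);
      split; eauto using gen_list_step, gen_num_step.
Qed.

Lemma rel_step_lift R S' (W W' : term -> Prop) :
  (forall s t, W s -> rstep S' s t -> W t) -> (forall s t, W s -> root_step R s t -> W' t) ->
  forall s t, W s -> rel_step R S' s t -> W' t.
Proof.
  intros H1 H2 s t Hs (v & Hv & Hr). apply (H2 v); [clear Hr|exact Hr].
  apply clos_rt_rtn1 in Hv. induction Hv; eauto.
Qed.

Lemma inv_rel_step n p q st t t' : inv n p q st t ->
  rel_step (sys n p q) (sys n p q) t t' ->
  exists st', inv n p q st' t' /\ prefix (known st) (known st') /\ clock st < clock st'.
Proof.
  intro H. apply (rel_step_lift _ _
    (fun t => exists st', inv n p q st' t /\ prefix (known st) (known st') /\ clock st <= clock st')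
    (fun t => exists st', inv n p q st' t /\ prefix (known st) (known st') /\ clock st < clock st')).
  - intros s u (st' & Hi & HP & Hc) Hs.
    destruct (inv_step _ _ _ _ _ _ Hi Hs) as (st2 & Hi2 & HP2 & Hc2).
    exists st2. split; [exact Hi2|]. split; [eapply prefix_trans; eauto|lia].
  - intros s u (st' & Hi & HP & Hc) Hs.
    destruct (inv_root _ _ _ _ _ _ Hi Hs) as (st2 & Hi2 & HP2 & Hc2).
    exists st2. split; [exact Hi2|]. split; [eapply prefix_trans; eauto|lia].
  - exists st. split; [exact H|]. split; [apply prefix_refl|lia].
Qed.

(** * Reaching the invariant from an arbitrary term *)

Definition root (t : term) : nat := match t with Var _ => 0 | Fn f _ => f end.

(** No right-hand side is a variable, so the root symbol of the result can be read off the rule. *)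
Lemma rt_root n p q s t : rt n p q s t ->
  root s < sRun /\ root t < root s \/ sRun <= root s /\ sRun <= root t.
Proof.
  destruct 1; simpl; try lia. destruct n; simpl; lia.
Qed.

Lemma rstep_root n p q s t : rstep (sys n p q) s t ->
  root t <= root s \/ sRun <= root t.
Proof.
  inversion 1 as [a b Hr|]; [|now left].
  apply root_step_rt, rt_root in Hr. lia.
Qed.

Lemma rstep_run n p q s t : sRun <= root s -> rstep (sys n p q) s t -> sRun <= root t.
Proof.
  intros H Hs. inversion Hs as [a b Hr|f ls rs a b Hr Ea Eb].
  - apply root_step_rt, rt_root in Hr. lia.
  - now subst.
Qed.

Lemma rel_step_root n p q s t : rel_step (sys n p q) (sys n p q) s t ->
  root t < root s \/ sRun <= root t.
Proof.
  apply (rel_step_lift _ _ (fun t => root t <= root s \/ sRun <= root t)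
    (fun t => root t < root s \/ sRun <= root t)); [| |now left].
  - intros u v H Hs. destruct H.
    + apply rstep_root in Hs. lia.
    + right. eapply rstep_run; eauto.
  - intros u v H Hs. apply root_step_rt, rt_root in Hs. lia.
Qed.

(** Whatever [l] and [x] were, [sExt] and [sNorm] can deliver only proper lists and numerals.
    Nothing is verified yet, hence the empty segment and stage 0. *)
Lemma test_root_inv n p q s t : root s = sTest -> root_step (sys n p q) s t ->
  exists st, inv n p q st t.
Proof.
  intros H Hr. apply root_step_rt in Hr. inversion Hr; subst; try discriminate H.
  exists {| known := []; stage := 0; testing := false |}. split; simpl; [lia|].
  do 2 eexists. split; [reflexivity|]. split; constructor.
  - intro M. now exists M.
  - constructor. lia.
Qed.

(** Ranks cannot decrease forever, so a root symbol of at least [sRun] appears and persists; a root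
    step at [sTest] then happens within two further relative steps. *)
Lemma eventually_inv n p q seq :
  (forall i, rel_step (sys n p q) (sys n p q) (seq i) (seq (S i))) ->
  exists i st, inv n p q st (seq i).
Proof.
  intro H.
  assert (Hrun : exists i, sRun <= root (seq i)).
  { apply NNPP. intro K.
    assert (L : forall i, root (seq i) + i <= root (seq 0)).
    { induction i as [|i IH]; [lia|].
      destruct (rel_step_root _ _ _ _ _ (H i)); [lia|]. destruct K. eauto. }
    specialize (L (S (root (seq 0)))). lia. }
  destruct Hrun as [i Hi]. exists (S (S i)).
  pose (W := fun t => root t = sTest \/ exists st, inv n p q st t).
  apply (rel_step_lift (sys n p q) (sys n p q) W (fun t => exists st, inv n p q st t)) with (s := seq (S i)); auto.
  - intros s t [Hs|[st Hs]] Hr.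
    + inversion Hr as [a b Hr'|]; subst; [|now left]. right. eapply test_root_inv; eauto.
    + right. destruct (inv_step _ _ _ _ _ _ Hs Hr) as (st' & Hst' & _). eauto.
  - intros s t [Hs|[st Hs]] Hr.
    + eapply test_root_inv; eauto.
    + destruct (inv_root _ _ _ _ _ _ Hs Hr) as (st' & Hst' & _). eauto.
  - apply (rel_step_lift (sys n p q) (sys n p q) (fun t => sRun <= root t) W) with (s := seq i); auto.
    + intros s t Hs. now apply rstep_run.
    + intros s t Hs Hr. assert (Hr' := Hr). apply root_step_rt in Hr'.
      inversion Hr'; subst; simpl in Hs; try lia; [now left|].
      right. eapply test_root_inv; [|exact Hr]. reflexivity.
Qed.

Lemma sys_sound n p q seq :
  (forall i, rel_step (sys n p q) (sys n p q) (seq i) (seq (S i))) ->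
  exists ga, forall x, holds n p q ga x.
Proof.
  intro H. destruct (eventually_inv _ _ _ _ H) as (i0 & st0 & H0).
  destruct (choice_fun (fun (x : nat * state) st' => inv n p q (snd x) (seq (fst x)) ->
    inv n p q st' (seq (S (fst x))) /\ prefix (known (snd x)) (known st') /\
    clock (snd x) < clock st')) as [next Hnext].
  { intros [i st]. simpl. destruct (classic (inv n p q st (seq i))) as [K|K].
    - destruct (inv_rel_step _ _ _ _ _ _ K (H i)) as (st' & Hst'). now exists st'.
    - now exists st. }
  pose (sts := fix sts i := match i with 0 => st0 | S i => next (i + i0, sts i) end).
  assert (Hinv : forall i, inv n p q (sts i) (seq (i + i0))).
  { induction i as [|i IH]; [exact H0|]. apply (Hnext (i + i0, sts i)), IH. }
  assert (Hmono : forall i j, i <= j -> prefix (known (sts i)) (known (sts j))).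
  { intros i j Hij. induction Hij as [|j _ IH]; [apply prefix_refl|].
    eapply prefix_trans; [exact IH|]. apply (Hnext (j + i0, sts j)), Hinv. }
  assert (Hclock : forall i, i <= clock (sts i)).
  { induction i as [|i IH]; [lia|].
    assert (K := proj2 (proj2 (Hnext (i + i0, sts i) (Hinv i)))). simpl in K |- *. lia. }
  (* [ga] extends the union of the nested known segments. Its values elsewhere are arbitrary, since
     the invariant speaks of every extension. *)
  destruct (graph_function (fun m v => exists i, m < length (known (sts i)) /\
    nth m (known (sts i)) 0 = v) 0) as [ga Hga].
  { intros m v v' (i & Hi & <-) (j & Hj & <-).
    destruct (Nat.le_ge_cases i j) as [Hij|Hij]; destruct (Hmono _ _ Hij) as [M E]; rewrite E;
      [symmetry|]; now apply app_nth1. }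
  (* A clock of at least [2 * x + 3] forces the stage beyond [x], as the phase contributes at most
     one. *)
  exists ga. intro x. apply (proj1 (Hinv (2 * x + 3))).
  - intros m Hm. symmetry. apply Hga. eauto.
  - specialize (Hclock (2 * x + 3)). unfold clock in Hclock.
    destruct (testing (sts (2 * x + 3))); lia.
Qed.

(** * Completeness *)

Definition reds (n : nat) (p q : bterm) : term -> term -> Prop :=
  clos_refl_trans term (rstep (sys n p q)).

Lemma reds_trans n p q s t u : reds n p q s t -> reds n p q t u -> reds n p q s u.
Proof. apply rt_trans. Qed.

Lemma reds_rt n p q s t u : rt n p q s t -> reds n p q t u -> reds n p q s u.
Proof.
  intros H. apply rt_trans, rt_step, rs_root. now apply root_step_rt.
Qed.

Lemma reds_ctx n p q f ls rs s t : reds n p q s t ->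
  reds n p q (Fn f (ls ++ s :: rs)) (Fn f (ls ++ t :: rs)).
Proof.
  induction 1; [apply rt_step; now apply rs_ctx|apply rt_refl|eapply rt_trans; eauto].
Qed.

Lemma reds_arg n p q f s t u : reds n p q s t -> reds n p q (Fn f [t]) u ->
  reds n p q (Fn f [s]) u.
Proof. intro H. apply reds_trans. exact (reds_ctx n p q f [] [] s t H). Qed.

Lemma reds_args n p q f s t s' t' u : reds n p q s s' -> reds n p q t t' ->
  reds n p q (Fn f [s'; t']) u -> reds n p q (Fn f [s; t]) u.
Proof.
  intros H H'. apply reds_trans. eapply reds_trans.
  - exact (reds_ctx n p q f [] [t] s s' H).
  - exact (reds_ctx n p q f [s'] [] t t' H').
Qed.

Lemma reds_copy n p q v : reds n p q (Fn sCopy [num v]) (num v).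
Proof.
  induction v as [|v IH]; simpl.
  - eapply reds_rt; [constructor|apply rt_refl].
  - eapply reds_rt; [constructor|]. eapply reds_arg; [exact IH|apply rt_refl].
Qed.

Lemma reds_add n p q a b : reds n p q (Fn sAdd [num a; num b]) (num (a + b)).
Proof.
  induction a as [|a IH]; simpl.
  - eapply reds_rt; [constructor|apply reds_copy].
  - eapply reds_rt; [constructor|]. eapply reds_arg; [exact IH|apply rt_refl].
Qed.

Lemma reds_mul n p q a b : reds n p q (Fn sMul [num a; num b]) (num (a * b)).
Proof.
  induction a as [|a IH]; simpl.
  - eapply reds_rt; [constructor|apply rt_refl].
  - eapply reds_rt; [constructor|]. eapply reds_args; [apply rt_refl|exact IH|apply reds_add].
Qed.

Lemma reds_get n p q l i : i < length l ->
  reds n p q (Fn sGet [lst l; num i]) (num (nth i l 0)).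
Proof.
  revert i. induction l as [|a l IH]; intros i Hi; simpl in Hi; [lia|].
  destruct i as [|i]; simpl; (eapply reds_rt; [constructor|]); [apply reds_copy|].
  eapply reds_arg; [apply IH; lia|apply reds_copy].
Qed.

Lemma reds_eq n p q a : reds n p q (Fn sEq [num a; num a]) 0'.
Proof.
  induction a as [|a IH]; simpl; (eapply reds_rt; [constructor|]); [apply rt_refl|].
  eapply reds_arg; [exact IH|apply (reds_copy n p q 0)].
Qed.

(** The bound [b] is a segment length at which every lookup succeeds. It works for all longer
    segments too, so the bounds of subterms can be added; a lookup at [k + k] asks for [S (k + k)]
    entries. *)
Lemma reds_code n p q ga v t : exists b, forall l, agrees l ga -> b <= length l ->
  reds n p q (code (lst l) (num v) t) (num (side n ga v t)).
Proof.
  unfold side.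
  induction t as [[|[|i]]| |u [b IH]|u [b IH] w [b' IH']|u [b IH] w [b' IH']|u [b IH]|u [b IH]].
  - exists 0. intros. apply rt_refl.
  - exists 0. intros. eapply reds_rt; [constructor|apply rt_refl].
  - exists 0. intros. apply rt_refl.
  - exists 0. intros. apply rt_refl.
  - exists b. intros l Hl Hb. eapply reds_arg; [now apply IH|apply rt_refl].
  - exists (b + b'). intros l Hl Hb.
    eapply reds_args; [apply IH; trivial; lia|apply IH'; trivial; lia|apply reds_add].
  - exists (b + b'). intros l Hl Hb.
    eapply reds_args; [apply IH; trivial; lia|apply IH'; trivial; lia|apply reds_mul].
  - set (k := beval _ _ _ u) in *. exists (b + S (k + k)). intros l Hl Hb. simpl. fold k.
    rewrite <- Hl by lia.
    eapply reds_args; [apply rt_refl| |apply reds_get; lia].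
    eapply reds_args; [apply IH; trivial; lia|apply IH; trivial; lia|apply reds_add].
  - set (k := beval _ _ _ u) in *. exists (b + S (S (k + k))). intros l Hl Hb. simpl. fold k.
    rewrite <- Hl by lia.
    eapply reds_args; [apply rt_refl| |apply reds_get; lia].
    eapply (reds_arg n p q sSucc); [|apply rt_refl].
    eapply reds_args; [apply IH; trivial; lia|apply IH; trivial; lia|apply reds_add].
Qed.

Lemma reds_eq_code n p q ga v : holds n p q ga v ->
  exists b, forall l, agrees l ga -> b <= length l ->
    reds n p q (eq_code (lst l) (num v) p q) 0'.
Proof.
  intro H. destruct (reds_code n p q ga v p) as [b Hb], (reds_code n p q ga v q) as [b' Hb'].
  exists (b + b'). intros l Hl Hlen.
  eapply reds_args; [apply Hb; trivial; lia|apply Hb'; trivial; lia|].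
  rewrite H. apply reds_eq.
Qed.

Lemma reds_check n p q ga j : (forall x, holds n p q ga x) ->
  exists b, forall l, agrees l ga -> b <= length l ->
    reds n p q (Fn sCheck [lst l; num j]) 0'.
Proof.
  intro H. induction j as [|j [b IH]].
  - destruct (reds_eq_code n p q ga 0 (H 0)) as [b Hb]. exists b. intros l Hl Hlen.
    eapply reds_rt; [constructor|]. now apply Hb.
  - destruct (reds_eq_code n p q ga (S j) (H (S j))) as [b' Hb']. exists (b + b').
    intros l Hl Hlen. simpl. eapply reds_rt; [constructor|].
    eapply reds_args; [apply IH; trivial; lia|apply Hb'; trivial; lia|apply (reds_add n p q 0 0)].
Qed.

Lemma reds_numS n p q v t : reds n p q t (Fn sOk [num v]) ->
  reds n p q (Fn sNumS [t]) (Fn sOk [num (S v)]).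
Proof.
  intro H. eapply reds_arg; [exact H|]. eapply reds_rt; [constructor|apply rt_refl].
Qed.

Lemma reds_norm n p q v : reds n p q (Fn sNorm [num v]) (Fn sOk [num v]).
Proof.
  induction v as [|v IH]; simpl; (eapply reds_rt; [constructor|]); [apply rt_refl|].
  now apply reds_numS.
Qed.

Lemma reds_pick n p q v : reds n p q (Fn sPick []) (Fn sOk [num v]).
Proof.
  induction v as [|v IH]; [eapply reds_rt; [apply rt_pick0|apply rt_refl]|].
  eapply reds_rt; [apply rt_pickS|]. now apply reds_numS.
Qed.

Lemma reds_listC n p q g t a l : reds n p q g (Fn sOk [num a]) ->
  reds n p q t (Fn sOk [lst l]) -> reds n p q (Fn sListC [g; t]) (Fn sOk [lst (a :: l)]).
Proof.
  intros Hg Ht. eapply reds_args; [exact Hg|exact Ht|].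
  eapply reds_rt; [constructor|apply rt_refl].
Qed.

Lemma reds_new n p q l : reds n p q (Fn sNew []) (Fn sOk [lst l]).
Proof.
  induction l as [|a l IH]; [eapply reds_rt; [apply rt_new0|apply rt_refl]|].
  eapply reds_rt; [apply rt_newS|]. apply reds_listC; [apply reds_pick|exact IH].
Qed.

Lemma reds_ext n p q l M : reds n p q (Fn sExt [lst l]) (Fn sOk [lst (l ++ M)]).
Proof.
  induction l as [|a l IH]; simpl; (eapply reds_rt; [constructor|]); [apply reds_new|].
  apply reds_listC; [apply reds_norm|exact IH].
Qed.

Definition segment (ga : nat -> nat) (m : nat) : list nat := map ga (List.seq 0 m).

Lemma agrees_segment ga m : agrees (segment ga m) ga.
Proof.
  intros i Hi. unfold segment in *. rewrite length_map, length_seq in Hi.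
  rewrite (nth_indep _ 0 (ga 0)) by now rewrite length_map, length_seq.
  rewrite map_nth, seq_nth; auto.
Qed.

Lemma segment_prefix ga m k : m <= k -> exists M, segment ga k = segment ga m ++ M.
Proof.
  intro H. exists (map ga (List.seq m (k - m))). unfold segment.
  rewrite <- map_app. f_equal. replace k with (m + (k - m)) at 1 by lia. apply seq_app.
Qed.

Lemma sys_complete n p q ga : (forall x, holds n p q ga x) ->
  exists seq, seq 0 = start /\ forall i, rel_step (sys n p q) (sys n p q) (seq i) (seq (S i)).
Proof.
  intro H.
  destruct (choice_fun _ (fun j => reds_check n p q ga j H)) as [b Hb].
  (* Accumulating the bounds makes the lengths nondecreasing, so that [sExt] can produce each
     segment from the previous one, while [b k] stays covered. *)
  pose (len := fix len k := match k with 0 => b 0 | S k => len k + b (S k) end).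
  assert (Hlen : forall k, b k <= len k) by (destruct k; simpl; lia).
  pose (L := fun k => lst (segment ga (len k))).
  (* [U k] opens the guessing phase of round [k], and [V k] its testing phase. *)
  pose (U := fun k => match k with 0 => start
    | S k => Fn sRun [Fn sExt [L k]; Fn sNumS [Fn sNorm [num k]]] end).
  pose (V := fun k => Fn sTest [L k; num k; Fn sCheck [L k; num k]]).
  assert (HUV : forall k, rel_step (sys n p q) (sys n p q) (U k) (V k)).
  { intro k. exists (Fn sRun [Fn sOk [L k]; Fn sOk [num k]]).
    split; [|apply root_step_rt; constructor]. destruct k as [|k]; unfold U.
    - apply (reds_ctx n p q sRun [] _ _ _ (reds_new n p q _)).
    - eapply reds_args; [| |apply rt_refl].
      + destruct (segment_prefix ga (len k) (len (S k))) as [M E]; [simpl; lia|].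
        unfold L. rewrite E. apply reds_ext.
      + apply reds_numS, reds_norm. }
  assert (HVU : forall k, rel_step (sys n p q) (sys n p q) (V k) (U (S k))).
  { intro k. exists (Fn sTest [L k; num k; 0']).
    split; [|apply root_step_rt; constructor].
    apply (reds_ctx n p q sTest [L k; num k] []). apply Hb; [apply agrees_segment|].
    unfold segment. rewrite length_map, length_seq. apply Hlen. }
  pose (st := fix st i := match i with 0 => (0, false)
    | S i => let (k, c) := st i in if c : bool then (S k, false) else (k, true) end).
  exists (fun i => let (k, c) := st i in if c : bool then V k else U k).
  split; [reflexivity|]. intro i. simpl. destruct (st i) as [k [|]]; auto.
Qed.

(** * The reduction *)

Lemma var_occ_num x n : ~ var_occ x (num n).
Proof.
  induction n as [|n IH]; simpl; rewrite var_occ_Fn, ?Exists_cons, Exists_nil; tauto.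
Qed.

Lemma var_occ_code x l y t : var_occ x (code l y t) -> var_occ x l \/ var_occ x y.
Proof.
  induction t as [[|[|i]]| | | | | |]; simpl;
    rewrite ?var_occ_Fn, ?Exists_cons, ?Exists_nil, ?var_occ_Fn, ?Exists_cons, ?Exists_nil,
      ?var_occ_Fn, ?Exists_cons, ?Exists_nil; tauto.
Qed.

Lemma wf_sys n p q : wf_trs (sys n p q).
Proof.
  assert (K : forall x l y, var_occ x (eq_code l y p q) -> var_occ x l \/ var_occ x y).
  { intros x l y. unfold eq_code. rewrite var_occ_Fn, !Exists_cons, Exists_nil.
    intros [H|[H|[]]]; now apply var_occ_code in H. }
  intros rl Hin. unfold sys, base in Hin. cbn [In] in Hin.
  repeat (destruct Hin as [<-|Hin]; [split; cbn [fst snd]; [discriminate|intros x H]|]);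
    [ now apply var_occ_num in H | .. | destruct Hin];
    repeat (rewrite ?var_occ_Fn, ?Exists_cons, ?Exists_nil in H);
    repeat (rewrite var_occ_Fn || rewrite Exists_cons || rewrite Exists_nil); try tauto.
  - apply K in H. rewrite var_occ_Fn, Exists_nil in H. tauto.
  - assert (H' := K x v0 (sc v1)). rewrite var_occ_Fn, Exists_cons, Exists_nil in H'. tauto.
Qed.

(** * Computability of the reduction function *)

Definition computable2 (g : nat -> nat -> nat) : Prop :=
  exists p, forall a b, eval p [a; b] (g a b).

Lemma const_prog n : exists p, forall v, eval p v n.
Proof.
  induction n as [|n [p IH]]; [exists PZero; constructor|].
  exists (PComp PSucc [p]). intro v. econstructor; repeat constructor. apply IH.
Qed.

Lemma computable_const n : computable (fun _ => n).
Proof. destruct (const_prog n) as [p H]. exists p. intro. apply H. Qed.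

Lemma computable_id : computable (fun n => n).
Proof. exists (PProj 0). intro n. apply (ev_proj 0 [n]). simpl. lia. Qed.

Lemma computable_S f : computable f -> computable (fun n => S (f n)).
Proof.
  intros [p H]. exists (PComp PSucc [p]). intro n. econstructor; repeat constructor. apply H.
Qed.

Lemma computable_comp f g : computable f -> computable g -> computable (fun n => f (g n)).
Proof.
  intros [p H] [r K]. exists (PComp p [r]). intro n.
  econstructor; [repeat constructor; apply K|apply H].
Qed.

Lemma computable_comp2 g f1 f2 : computable2 g -> computable f1 -> computable f2 ->
  computable (fun n => g (f1 n) (f2 n)).
Proof.
  intros [p H] [r K] [r' K']. exists (PComp p [r; r']). intro n.
  econstructor; [repeat constructor; [apply K|apply K']|apply H].
Qed.

Lemma computable2_add : computable2 Nat.add.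
Proof.
  exists (PRec (PProj 0) (PComp PSucc [PProj 1])). intros a b.
  induction a as [|a IH]; simpl.
  - constructor. apply (ev_proj 0 [b]). simpl. lia.
  - econstructor; [exact IH|]. econstructor; [|constructor].
    repeat constructor.
Qed.

Lemma computable_rec f g : computable2 g -> (forall n, f (S n) = g n (f n)) -> computable f.
Proof.
  intros [p H] E. destruct (const_prog (f 0)) as [c Hc]. exists (PRec c p).
  induction n as [|n IH]; [constructor; apply Hc|].
  rewrite E. econstructor; [exact IH|apply H].
Qed.

Lemma computable_iter f g : computable g -> (forall n, f (S n) = g (f n)) -> computable f.
Proof.
  intros [p H] E. apply (computable_rec f (fun _ y => g y)); [|exact E].
  exists (PComp p [PProj 1]). intros a b. econstructor; [|apply H].
  repeat constructor.
Qed.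

(** Triangular numbers arise by primitive recursion, which avoids a program for division;
    [cpair_triangle] reduces pairing to them and addition. *)
Lemma computable_triangle : computable (fun n => cpair n 0).
Proof.
  apply (computable_rec _ (fun n y => y + S n)).
  - destruct computable2_add as [p H]. exists (PComp p [PProj 1; PComp PSucc [PProj 0]]).
    intros a b. econstructor; [|apply H]. constructor; [apply (ev_proj 1 [a; b]); simpl; lia|].
    constructor; [|constructor]. econstructor; [|constructor].
    constructor; [apply (ev_proj 0 [a; b]); simpl; lia|constructor].
  - intro n. symmetry. apply eq_cpair_iff. pose proof (double_cpair n 0). lia.
Qed.

Lemma cpair_triangle a b : cpair a b = cpair (a + b) 0 + b.
Proof. symmetry. apply eq_cpair_iff. pose proof (double_cpair (a + b) 0). lia. Qed.

Lemma computable_add f g : computable f -> computable g -> computable (fun n => f n + g n).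
Proof. apply computable_comp2, computable2_add. Qed.

Lemma computable_cpair f g : computable f -> computable g ->
  computable (fun n => cpair (f n) (g n)).
Proof.
  intros Hf Hg.
  replace (fun n => cpair (f n) (g n)) with (fun n => cpair (f n + g n) 0 + g n)
    by (apply functional_extensionality; intro; symmetry; apply cpair_triangle).
  apply computable_add; [|exact Hg].
  apply (computable_comp (fun n => cpair n 0)); [apply computable_triangle|].
  now apply computable_add.
Qed.

Lemma computable_num : computable (fun n => enc_term (num n)).
Proof.
  (* This maps the code [y] of a term to the code of its successor: 1 is the symbol [sSucc], and the
     repeated summand is the factor 2 in [enc_Fn]. *)
  apply (computable_iter _ (fun y => S (cpair 1 (S (cpair y 0)) + cpair 1 (S (cpair y 0))))).
  - assert (H : computable (fun y => cpair 1 (S (cpair y 0)))).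
    { apply computable_cpair; [apply computable_const|].
      apply computable_S, computable_cpair; [apply computable_id|apply computable_const]. }
    apply computable_S. now apply computable_add.
  - intro n. cbn [num]. rewrite enc_Fn. cbn [enc_list]. lia.
Qed.

Lemma computable_sys p q : computable (fun n => enc_trs (sys n p q)).
Proof.
  unfold sys. change (computable (fun n =>
    S (cpair (cpair (enc_term (Fn sInput [])) (enc_term (num n))) (enc_trs (base p q))))).
  apply computable_S, computable_cpair; [|apply computable_const].
  apply computable_cpair; [apply computable_const|apply computable_num].
Qed.

(** Each implication has the strongest form: termination on all terms entails termination on
    [start], so all four properties are squeezed between the two. *)
Lemma Pi11_reduction A : Pi11 A -> exists p q, forall n,
  (A n -> SN_rel (sys n p q) (sys n p q)) /\
  (SN_rel_on (sys n p q) (sys n p q) start -> A n).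
Proof.
  intro HA. destruct (Pi11_normal_form A HA) as (p & q & H). exists p, q. intro n. split.
  - intros Hn t (seq & _ & Hs). apply H in Hn. apply Hn. exact (sys_sound n p q seq Hs).
  - intro Hn. apply H. intros (ga & Hga). apply Hn. exact (sys_complete n p q ga Hga).
Qed.

Lemma SNrel_triples_code R S' t : wf_trs R -> wf_trs S' ->
  SNrel_triples (cpair (enc_trs R) (cpair (enc_trs S') (enc_term t))) <-> SN_rel_on R S' t.
Proof.
  intros HR HS. split.
  - intros (R2 & S2 & t2 & _ & _ & E & H). apply cpair_inj in E. destruct E as [E1 E].
    apply cpair_inj in E. destruct E as [E2 E3].
    apply enc_trs_inj in E1, E2. apply enc_term_inj in E3. now subst.
  - intro H. now exists R, S', t.
Qed.

Lemma SNrel_pairs_code R S' : wf_trs R -> wf_trs S' ->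
  SNrel_pairs (cpair (enc_trs R) (enc_trs S')) <-> SN_rel R S'.
Proof.
  intros HR HS. split.
  - intros (R2 & S2 & _ & _ & E & H). apply cpair_inj in E. destruct E as [E1 E2].
    apply enc_trs_inj in E1, E2. now subst.
  - intro H. now exists R, S'.
Qed.

Lemma SNrel_diag_pairs_code S' t : wf_trs S' ->
  SNrel_diag_pairs (cpair (enc_trs S') (enc_term t)) <-> SN_rel_on S' S' t.
Proof.
  intros HS. split.
  - intros (S2 & t2 & _ & E & H). apply cpair_inj in E. destruct E as [E1 E2].
    apply enc_trs_inj in E1. apply enc_term_inj in E2. now subst.
  - intro H. now exists S', t.
Qed.

Lemma SNrel_diag_code S' : wf_trs S' -> SNrel_diag (enc_trs S') <-> SN_rel S' S'.
Proof.
  intros HS. split.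
  - intros (S2 & _ & E & H). apply enc_trs_inj in E. now subst.
  - intro H. now exists S'.
Qed.

Theorem theorem7 :
  Pi11_complete SNrel_triples /\ Pi11_complete SNrel_pairs /\
  Pi11_hard SNrel_diag_pairs /\ Pi11_hard SNrel_diag.
Proof.
  split; [split; [apply Pi11_SNrel_triples|]|split; [split; [apply Pi11_SNrel_pairs|]|split]];
    intros A HA; destruct (Pi11_reduction A HA) as (p & q & H).
  - exists (fun n => cpair (enc_trs (sys n p q)) (cpair (enc_trs (sys n p q)) (enc_term start))).
    split.
    + apply computable_cpair; [apply computable_sys|].
      apply computable_cpair; [apply computable_sys|apply computable_const].
    + intro n. rewrite SNrel_triples_code by apply wf_sys. destruct (H n) as [H1 H2].
      split; [intro K; now apply H1|exact H2].
  - exists (fun n => cpair (enc_trs (sys n p q)) (enc_trs (sys n p q))). split.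
    + apply computable_cpair; apply computable_sys.
    + intro n. rewrite SNrel_pairs_code by apply wf_sys. destruct (H n) as [H1 H2].
      split; [exact H1|intro K; apply H2, K].
  - exists (fun n => cpair (enc_trs (sys n p q)) (enc_term start)). split.
    + apply computable_cpair; [apply computable_sys|apply computable_const].
    + intro n. rewrite SNrel_diag_pairs_code by apply wf_sys. destruct (H n) as [H1 H2].
      split; [intro K; now apply H1|exact H2].
  - exists (fun n => enc_trs (sys n p q)). split; [apply computable_sys|].
    intro n. rewrite SNrel_diag_code by apply wf_sys. destruct (H n) as [H1 H2].
    split; [exact H1|intro K; apply H2, K].
Qed.
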